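(* For every $\alpha\in(0,1)$ one has $$\alpha\,(1-\alpha)^{\frac{1-\alpha}{\alpha}}\,\mathbf{L}^{-\frac{1-\alpha}{\alpha}}\;\prec_{st}\;\mathbf{Z}_\alpha\qquad\text{and}\qquad\Gamma(1-\alpha)^{-\frac1\alpha}\,\mathbf{L}^{-\frac1\alpha}\;\prec_{st}\;\mathbf{Z}_\alpha.$$
   Context: For $\alpha\in(0,1)$, $\mathbf{Z}_\alpha$ is the positive random variable with $\mathbb{E}[e^{-\lambda \mathbf{Z}_\alpha}]=e^{-\lambda^\alpha}$ for all $\lambda\ge0$. $\mathbf{L}$ is the unit exponential random variable (so $\mathbf{L}^{-\gamma}$, $\gamma>0$, has a Fréchet distribution). For real random variables $X,Y$, write $X\le_{st}Y$ if $\mathbb{P}[X\ge x]\le\mathbb{P}[Y\ge x]$ for all $x\in\mathbb{R}$. For positive random variables $X,Y$, the optimal stochastic order $X\prec_{st}Y$ means that $X\le_{st}Y$ and there is no $c>1$ such that $cX\le_{st}Y$. *)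

(* Defs.v *)
From HB Require Import structures.
From mathcomp Require Import all_boot all_order all_algebra.
From mathcomp Require Import all_classical all_reals all_analysis.
From mathcomp Require Import measurable_realfun.

Set Implicit Arguments.
Unset Strict Implicit.
Unset Printing Implicit Defensive.

Import Order.TTheory GRing.Theory Num.Theory.
Import numFieldNormedType.Exports.

Local Open Scope classical_set_scope.
Local Open Scope ring_scope.

(* Euler's integral; meaningful for 0 < x, where it converges *)
Definition Gamma {R : realType} (x : R) : R :=
  Rintegral lebesgue_measure `]0, +oo[ (fun t : R => t `^ (x - 1) * expR (- t)).

Section transformations.
Context d (T : measurableType d) (R : realType).

Definition scale_rv (c : R) (X : T -> R) : T -> R := fun w => c * X w.

Definition power_rv (X : T -> R) (p : R) : T -> R := fun w => X w `^ p.

Let measurable_scale_rv (c : R) (X : {mfun T >-> R}) :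
  measurable_fun setT (scale_rv c X).
Proof. exact: measurable_funM. Qed.

HB.instance Definition _ (c : R) (X : {mfun T >-> R}) :=
  isMeasurableFun.Build _ _ _ _ (scale_rv c X) (measurable_scale_rv c X).

Let measurable_power_rv (X : {mfun T >-> R}) (p : R) :
  measurable_fun setT (power_rv X p).
Proof. exact: (measurableT_comp (measurable_powR p)). Qed.

HB.instance Definition _ (X : {mfun T >-> R}) (p : R) :=
  isMeasurableFun.Build _ _ _ _ (power_rv X p) (measurable_power_rv X p).

End transformations.

Section stochastic_orders.
Context d d' (T : measurableType d) (T' : measurableType d') (R : realType).
Variables (P : probability T R) (Q : probability T' R).

(* X and Y may live on different probability spaces: only their laws matter. *)
Definition le_st (X : {RV P >-> R}) (Y : {RV Q >-> R}) : Prop :=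
  forall x : R, (P [set w | x <= X w]%R <= Q [set w | x <= Y w]%R)%E.

(* Intended for (almost surely) positive X and Y *)
Definition prec_st (X : {RV P >-> R}) (Y : {RV Q >-> R}) : Prop :=
  le_st X Y /\ ~ exists c : R, 1 < c /\ le_st (scale_rv c X) Y.

End stochastic_orders.

(* {RV P >-> R} does not determine P by unification. *)
Arguments le_st {d d' T T' R} P Q X Y.
Arguments prec_st {d d' T T' R} P Q X Y.

Section laws.
Context d (T : measurableType d) (R : realType) (P : probability T R).

Definition positive_stable (alpha : R) (Z : {RV P >-> R}) : Prop :=
  {ae P, forall w, 0 < Z w} /\
  forall lambda : R, 0 <= lambda ->
    'E_P[fun w => expR (- (lambda * Z w))]%E
    = (expR (- (lambda `^ alpha)))%:E.

(* Laws are compared on measurable sets only: the values of the two set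
   functions on nonmeasurable sets carry no information. *)
Definition unit_exponential (L : {RV P >-> R}) : Prop :=
  forall A : set R, measurable A -> distribution P L A = exponential_prob 1 A.

End laws.

Arguments positive_stable {d T R} P alpha Z.
Arguments unit_exponential {d T R} P L.

(* Main.v *)
(**
Write s = l^alpha. Comparing with L^(-(1-alpha)/alpha) amounts to bounding
P[Z < x] near 0. The lower bound on the tail is Chernoff's inequality
P[Z < x] <= exp(l x - s) at the optimal l. If a constant c > 1 could be
inserted, bounding exp(-l Z) by a step function with N steps and applying
Young's inequality on each step would give
exp(-s) <= exp(-2 s) + N exp(2 s / N - c^alpha s), which fails for large s.

For L^(-1/alpha) the point is that Z dominates the largest jump of the stable
subordinator on [0, 1]. This is made elementary by Poissonization: if K is
Poisson with random mean l Z, then E[t^K] = exp(-s (1 - t)^alpha), a compound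
Poisson law whose jumps have generating function 1 - (1 - t)^alpha (Sibuya
law). Keeping only the coefficients of t^k with k <= m gives
P[K <= m] <= exp(-s w) and P[K <= m] >= exp(-s) (1 + s (1 - w)), where
w = prod_(1 <= j <= m) (1 - alpha / j) = Gamma(m+1-alpha) / (Gamma(1-alpha) m!)
is the Sibuya tail. Jensen's inequality for the Gamma law gives
w ~ m^(-alpha) / Gamma(1-alpha), and K concentrates around l Z by Chernoff's
bound. Letting m tend to infinity with l x / m fixed gives the inequality;
letting l tend to 0 first, and then m to infinity, gives optimality.
*)
Require Import Defs.
From mathcomp Require Import all_boot all_order all_algebra.
From mathcomp Require Import all_classical all_reals all_analysis.
From mathcomp Require Import measurable_realfun ring lra.

Set Implicit Arguments.
Unset Strict Implicit.
Unset Printing Implicit Defensive.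

Import Order.TTheory GRing.Theory Num.Theory.
Import numFieldNormedType.Exports.

Local Open Scope classical_set_scope.
Local Open Scope ring_scope.

(** * Tangent-line bounds and limits for real powers *)

Section power_function.
Variable R : realType.
Implicit Types a b r t : R.

(** Young's inequality with conjugate exponents 1/b and 1/(1-b), applied to t^b and 1. *)
Lemma powR_le_affine b t : 0 < b -> b < 1 -> 0 <= t ->
  t `^ b <= b * t + (1 - b).
Proof.
move=> b0 b1 t0.
have b1' : 0 < 1 - b by rewrite subr_gt0.
have := @conjugate_powR R (t `^ b) 1 b^-1 (1 - b)^-1 (powR_ge0 _ _) ler01.
rewrite !invr_gt0 b0 b1' !invrK addrC subrK => /(_ erefl erefl erefl).
by rewrite -powRrM divff ?gt_eqF// powRr1// powR1 mulr1 mul1r mulrC.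
Qed.

(** The power is concave, so it lies below its tangent at [r]; this is the tangent at 1 rescaled
    through [t / r]. *)
Lemma powR_le_tangent b r t : 0 < b -> b < 1 -> 0 < r -> 0 <= t ->
  t `^ b <= r `^ b + b * r `^ (b - 1) * (t - r).
Proof.
move=> b0 b1 r0 t0.
have tr0 : 0 <= t / r by rewrite divr_ge0// ltW.
have := powR_le_affine b0 b1 tr0.
rewrite -(ler_pM2r (powR_gt0 b r0)) -powRM ?(ltW r0)// divfK ?gt_eqF//.
move=> /le_trans; apply.
rewrite powRB; last by apply/implyP => _; rewrite gt_eqF.
rewrite powRr1 ?(ltW r0)// le_eqVlt; apply/orP; left; apply/eqP.
by field; rewrite gt_eqF.
Qed.

Lemma powR_le_expR b t : 0 < b -> 0 <= t -> t `^ b <= b `^ b * expR t.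
Proof.
move=> b0 t0.
have tb0 : 0 <= t / b by rewrite divr_ge0// ltW.
rewrite -{1}(divfK (lt0r_neq0 b0) t) powRM ?(ltW b0)// mulrC.
rewrite ler_pM2l ?powR_gt0// -[t in X in _ <= X](divfK (lt0r_neq0 b0)) expRM.
rewrite ge0_ler_powR ?nnegrE ?(ltW b0) ?expR_ge0//.
by rewrite (le_trans _ (expR_ge1Dx _))// lerDr.
Qed.

Lemma cvgn_powR_expRN b : 0 < b ->
  (n.+2%:R `^ b * expR (- n.+2%:R) : R) @[n --> \oo] --> 0.
Proof.
move=> b0.
have C0 : 0 < 2 * (2 * b) `^ b by rewrite mulr_gt0// powR_gt0// mulr_gt0.
apply: (@squeeze_cvgr _ _ _ _ (fun=> 0) (fun n => (2 * (2 * b) `^ b) * n.+1%:R^-1)).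
- apply: nearW => n; rewrite mulr_ge0 ?powR_ge0 ?expR_ge0//=.
  set t : R := n.+2%:R.
  have t0 : 0 <= t / 2 by rewrite divr_ge0.
  (* Half of the exponential absorbs the power; the other half is left to tend to 0. *)
  have h1 : t `^ b <= (2 * b) `^ b * expR (t / 2).
    have -> : t `^ b = 2 `^ b * (t / 2) `^ b.
      by rewrite -powRM// mulrC divfK.
    by rewrite (powRM _ _ (ltW b0))// -mulrA ler_pM2l ?powR_gt0// powR_le_expR.
  have h2 : t `^ b * expR (- t) <= (2 * b) `^ b * expR (- (t / 2)).
    rewrite (le_trans (ler_wpM2r (expR_ge0 _) h1))// -mulrA -expRD.
    by rewrite (_ : t / 2 - t = - (t / 2))//; field.
  apply: (le_trans h2); rewrite [2 * _ `^ _]mulrC -[leRHS]mulrA ler_wpM2l ?powR_ge0//.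
  rewrite expRN -[X in _ <= X]invrK lef_pV2 ?posrE ?expR_gt0 ?invr_gt0 ?mulr_gt0//.
  apply: (le_trans _ (expR_ge1Dx _)).
  have -> : (2 * n.+1%:R^-1)^-1 = n.+1%:R / 2 :> R by rewrite invfM invrK mulrC.
  rewrite /t -[n.+2%:R]natr1; lra.
- exact: cvg_cst.
- rewrite -(mulr0 (2 * (2 * b) `^ b)); apply: cvgMr; exact: cvg_harmonic.
Qed.

Lemma cvgn_powRN b : 0 < b -> ((n.+2%:R^-1) `^ b : R) @[n --> \oo] --> 0.
Proof.
move=> b0; have /cvg_at_rightP := powR_cvg0 b0; apply; split.
  by move=> n; rewrite invr_gt0.
have := @cvg_harmonic R; rewrite -cvg_shiftS; exact.
Qed.

Lemma is_derive_expRN t : is_derive t 1 (fun u : R => expR (- u)) (- expR (- t)).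
Proof.
have dN : is_derive t 1 (@GRing.opp R) (- 1) by exact: is_deriveNid.
have := is_derive1_comp (is_derive_expR (- t)) dN => /is_derive_eq; apply.
by rewrite mulrN1.
Qed.

End power_function.

(** * Euler's integral through truncation to compact intervals *)

Section gamma_function.
Variable R : realType.
Implicit Types (z b r t : R) (n : nat).
Local Notation mu := (@lebesgue_measure R).

Let integrand z t : R := t `^ (z - 1) * expR (- t).
(** The endpoints 1/(n+2) < 1 < n+2 give nondegenerate compact intervals inside the open half-line,
    where the integrand is continuous for every real [z] and the fundamental theorem of calculus
    applies. *)
Let D n : set R := `[(n.+2%:R^-1 : R), n.+2%:R].
Let I z n := Rintegral mu (D n) (integrand z).
Let F z t : R := t `^ z * expR (- t).

Let D_gt0 n t : D n t -> 0 < t.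
Proof. by rewrite /D /= in_itv/= => /andP[+ _]; apply: lt_le_trans; rewrite invr_gt0. Qed.

Let measurable_D n : (R.-ocitv.-measurable).-sigma.-measurable (D n).
Proof. exact: measurable_itv. Qed.

Let invn_ltn n : n.+2%:R^-1 < n.+2%:R :> R.
Proof. by apply: (@lt_le_trans _ _ 1); rewrite ?invf_lt1 ?ltr1n ?ler1n. Qed.

Let is_derive_F z t : 0 < t ->
  is_derive t 1 (F z) (z * integrand z t - integrand (z + 1) t).
Proof.
move=> t0; have de : is_derive t 1 (fun u : R => expR (- u)) (- expR (- t)).
  exact: is_derive_expRN.
have := is_deriveM (is_derive1_powR z t0) de => /is_derive_eq; apply.
by rewrite /integrand addrK /GRing.scale /=; ring.
Qed.

Let continuous_F z t : 0 < t -> {for t, continuous (F z)}.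
Proof.
move=> t0; apply: differentiable_continuous; apply/derivable1_diffP.
by have [] := is_derive_F z t0.
Qed.

Let integrandE z : integrand z = F (z - 1). Proof. by []. Qed.

Let continuous_within_integrand z n : {within D n, continuous integrand z}.
Proof.
apply: continuous_in_subspaceT => t; rewrite inE => /D_gt0 t0.
by rewrite integrandE; exact: continuous_F.
Qed.

Let integrable_integrand z n : mu.-integrable (D n) (EFin \o integrand z).
Proof.
apply: continuous_compact_integrable; first exact: segment_compact.
exact: continuous_within_integrand.
Qed.

Let Iparts z n : z * I z n - I (z + 1) n = F z n.+2%:R - F z n.+2%:R^-1.
Proof.
rewrite /I -RintegralZl//.
rewrite -RintegralB//; last 2 first.
- exact: (integrableZl (measurable_D n) z (integrable_integrand z n)).
- exact: integrable_integrand.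
rewrite /Rintegral (@continuous_FTC2 _ _ (F z))//=.
- apply: continuous_in_subspaceT => t; rewrite inE => /D_gt0 t0.
  have ci w : {for t, continuous (integrand w)}.
    by rewrite integrandE; exact: continuous_F.
  by apply: cvgB; [apply: cvgMr; exact: ci|exact: ci].
- split.
  + move=> t; rewrite in_itv/= => /andP[nt _].
    have t0 : 0 < t by apply: lt_trans nt; rewrite invr_gt0.
    by have [] := is_derive_F z t0.
  + by apply: cvg_at_right_filter; apply: continuous_F; rewrite invr_gt0.
  + by apply: cvg_at_left_filter; exact: continuous_F.
- move=> t; rewrite in_itv/= => /andP[nt _].
  have t0 : 0 < t by apply: lt_trans nt; rewrite invr_gt0.
  by rewrite derive1E; have [_ ->] := is_derive_F z t0.
exact: (integrable_integrand z n).
Qed.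

Let I_ge0 z n : 0 <= I z n.
Proof. by apply: Rintegral_ge0 => t _; rewrite mulr_ge0 ?powR_ge0 ?expR_ge0. Qed.

Let cvg_Fdiff z : 0 < z -> (F z n.+2%:R - F z n.+2%:R^-1) @[n --> \oo] --> 0.
Proof.
move=> z0; rewrite -[0]subr0; apply: cvgB; first exact: cvgn_powR_expRN.
apply: (@squeeze_cvgr _ _ _ _ (fun=> 0) (fun n => (n.+2%:R^-1) `^ z)).
- apply: nearW => n; rewrite /F mulr_ge0 ?powR_ge0 ?expR_ge0//=.
  by rewrite ler_piMr ?powR_ge0// expR_le1 oppr_le0 invr_ge0.
- exact: cvg_cst.
- exact: cvgn_powRN.
Qed.

Let bounded_Fdiff z : 0 < z ->
  exists M : R, forall n, `|F z n.+2%:R - F z n.+2%:R^-1| <= M.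
Proof.
move=> z0; have /cvgP/cvg_seq_bounded [M [_ /(_ (M + 1))]] := cvg_Fdiff z0.
rewrite ltrDl ltr01 => /(_ erefl) H; exists (M + 1) => n; exact: H.
Qed.

(** The tangent bound at [r] is integrated against the weight t^(z-1) exp(-t). For [r = z] the
    correction term vanishes in the limit, which yields Jensen's inequality. *)
Let Ile z b n : 0 < b -> b < 1 -> forall r, 0 < r ->
  I (z + b) n <= r `^ b * I z n + b * r `^ (b - 1) * (I (z + 1) n - r * I z n).
Proof.
move=> b0 b1 r r0.
set c := b * r `^ (b - 1).
have ii y : mu.-integrable (D n) (EFin \o integrand y) by exact: integrable_integrand.
have iz (k : R) y : mu.-integrable (D n) (EFin \o (fun t => k * integrand y t)).
  apply: (integrableZl (measurable_D n) k (ii y)).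
apply: (@le_trans _ _ (Rintegral mu (D n)
    (fun t => (r `^ b - c * r) * integrand z t + c * integrand (z + 1) t))).
  apply: le_Rintegral => //.
    exact: ii.
    by apply: (integrableD (measurable_D n) (iz _ z) (iz _ (z + 1))).
  move=> t /D_gt0 t0; rewrite /integrand.
  have tz y : t `^ (z + y - 1) = t `^ (z - 1) * t `^ y.
    by rewrite addrAC (@powRD _ t (z - 1) y)//; apply/implyP => _; rewrite gt_eqF.
  rewrite !tz (powRr1 (ltW t0)) !mulrA -mulrDl ler_wpM2r ?expR_ge0//.
  have := ler_wpM2l (powR_ge0 t (z - 1)) (powR_le_tangent b0 b1 r0 (ltW t0)).
  rewrite -/c => h; apply: (le_trans h).
  by rewrite le_eqVlt; apply/orP; left; apply/eqP; ring.
rewrite RintegralD// !RintegralZl//.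
by rewrite le_eqVlt; apply/orP; left; apply/eqP; rewrite /I; ring.
Qed.

(** Integration by parts will transfer such bounds between [z] and [z + 1], because its boundary
    terms form a bounded sequence. *)
Let bounded z := exists M, forall n, I z n <= M.

Let bounded_step z : 0 < z -> bounded z <-> bounded (z + 1).
Proof.
move=> z0; have [K HK] := bounded_Fdiff z0; split => -[M HM].
- exists (z * M + K) => n.
  have := HK n; rewrite -Iparts ler_norml => /andP[+ _].
  by have := ler_wpM2l (ltW z0) (HM n); lra.
- exists ((M + K) / z) => n; rewrite ler_pdivlMr//.
  have := HK n; rewrite -Iparts ler_norml => /andP[_].
  by have := HM n; lra.
Qed.

Let bounded1 : bounded 1.
Proof.
exists 1 => n.
have e1 : integrand 1 = fun t => expR (- t).
  by apply/funext => t; rewrite /integrand subrr powRr0 mul1r.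
rewrite /I e1 {1}/Rintegral /Rintegral.
rewrite (@continuous_FTC2 _ _ (fun t => - expR (- t)))//=.
- apply: continuous_subspaceT => t; apply: continuous_comp; first exact: opp_continuous.
  exact: continuous_expR.
- have c t : {for t, continuous (fun t : R => - expR (- t))}.
    apply: continuousN; apply: continuous_comp; first exact: opp_continuous.
    exact: continuous_expR.
  split => //.
  + by apply: cvg_at_right_filter; exact: c.
  + by apply: cvg_at_left_filter; exact: c.
- move=> t _; rewrite derive1E.
  by have [_ ->] := is_deriveN (is_derive_expRN t); rewrite opprK.
Qed.

(** For [b] in (0, 1), [Ile] bounds the integral at 1 + b by those at 1 and 2, and [bounded_step]
    descends to [b]; larger arguments follow by unit steps. *)
Let bounded_gt0 z : 0 < z -> bounded z.
Proof.
move=> z0.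
have small b : 0 < b -> b < 1 -> bounded b.
  move=> b0 b1; apply/bounded_step => //.
  have [M2 HM2] := (bounded_step ltr01).1 bounded1.
  have [M1 HM1] := bounded1.
  exists (M1 + b * M2) => n; rewrite addrC.
  apply: (le_trans (Ile 1 n b0 b1 ltr01)).
  rewrite !powR1.
  have := ler_wpM2l (ltW b0) (HM2 n).
  have := HM1 n; have := mulr_ge0 (ltW b0) (I_ge0 1 n).
  lra.
have H n : forall y, 0 < y -> y <= n%:R -> bounded y.
  elim: n => [y y0|n IH y y0 yn]; first by rewrite leNgt y0.
  have [y1|y1|->] := ltgtP y 1; [exact: small| |exact: bounded1].
  rewrite -(subrK 1 y); apply: (bounded_step _).1; rewrite ?subr_gt0//.
  by apply: IH; [rewrite subr_gt0|rewrite lerBlDr natr1].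
by apply: (H (Num.truncn z).+1) => //; rewrite ltW// truncnS_gt.
Qed.

Let nondecreasing_D : {homo D : n m / (n <= m)%N >-> (n <= m)%O}.
Proof.
move=> n m nm; apply/subsetPset => t; rewrite /D/= !in_itv/= => /andP[a b].
rewrite (le_trans _ a) ?(le_trans b) ?ler_nat ?ltnS//.
by rewrite lef_pV2 ?posrE// ler_nat !ltnS.
Qed.

Let bigcup_D : \bigcup_n D n = `]0, +oo[%classic.
Proof.
apply/seteqP; split=> [t [n _ /D_gt0]|t]/=; rewrite in_itv/= andbT// => t0.
exists (maxn (Num.truncn t) (Num.truncn t^-1)) => //=.
set n := maxn _ _.
have tn : t < n.+2%:R.
  by apply: lt_trans (truncnS_gt t) _; rewrite ltr_nat !ltnS leq_maxl.
have vn : t^-1 < n.+2%:R.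
  by apply: lt_trans (truncnS_gt t^-1) _; rewrite ltr_nat !ltnS leq_maxr.
rewrite /D/= in_itv/= (ltW tn) andbT -[leRHS]invrK lef_pV2 ?posrE ?invr_gt0//.
exact: ltW.
Qed.

(** Monotone convergence. Finiteness has to come from the uniform bound, since [Rintegral] would
    send an infinite integral to 0. *)
Let cvg_I z : 0 < z -> I z n @[n --> \oo] --> Gamma z.
Proof.
move=> z0.
have IE n : (\int[mu]_(x in D n) (integrand z x)%:E = (I z n)%:E)%E.
  rewrite /I /Rintegral fineK//.
  exact: (integrable_fin_num (measurable_D n) (integrable_integrand z n)).
have H : (\int[mu]_(x in D n) (integrand z x)%:E)%E @[n --> \oo] -->
    (\int[mu]_(x in `]0%R, +oo[) (integrand z x)%:E)%E.
  rewrite -bigcup_D; apply: ge0_nondecreasing_set_cvg_integral => //.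
  - by move=> n; have /integrableP[] := integrable_integrand z n.
  - by move=> n t _; rewrite lee_fin mulr_ge0 ?powR_ge0 ?expR_ge0.
have [M HM] := bounded_gt0 z0.
have fin : (\int[mu]_(x in `]0%R, +oo[) (integrand z x)%:E)%E \is a fin_num.
  rewrite ge0_fin_numE; last first.
    by apply: integral_ge0 => t _; rewrite lee_fin mulr_ge0 ?powR_ge0 ?expR_ge0.
  apply: (@le_lt_trans _ _ M%:E); last exact: ltry.
  rewrite -(cvg_lim _ H)//; apply: lime_le; first by apply/cvg_ex; eexists; exact: H.
  by apply: nearW => n; rewrite IE lee_fin.
move: H; rewrite -(fineK fin) => /fine_cvg.
by under [X in X @ _]funext do rewrite /= IE /=.
Qed.

Lemma GammaD1 z : 0 < z -> Gamma (z + 1) = z * Gamma z.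
Proof.
move=> z0; apply/esym/eqP; rewrite -subr_eq0; apply/eqP.
have H1 : (z * I z n - I (z + 1) n) @[n --> \oo] --> z * Gamma z - Gamma (z + 1).
  apply: cvgB; last by apply: cvg_I; rewrite addr_gt0.
  by apply: cvgMr; exact: cvg_I.
rewrite -(cvg_lim _ H1)//.
by under eq_fun do rewrite Iparts; apply: cvg_lim => //; exact: cvg_Fdiff.
Qed.

(* Jensen's inequality for the concave power [t `^ b] under the Gamma(z)
   distribution, whose mean is [z]. *)
Lemma GammaD_le z b : 0 < z -> 0 < b -> b < 1 ->
  Gamma (z + b) <= z `^ b * Gamma z.
Proof.
move=> z0 b0 b1.
have := GammaD1 z0 => G1.
rewrite [X in _ <= X](_ : _ = z `^ b * Gamma z +
   b * z `^ (b - 1) * (Gamma (z + 1) - z * Gamma z)); last first.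
  by rewrite G1 subrr mulr0 addr0.
apply: (ler_cvg_to (cvg_I (addr_gt0 z0 b0))); last first.
  by apply: nearW => n; exact: (Ile z n b0 b1 z0).
apply: cvgD; first by apply: cvgMr; exact: cvg_I.
apply: cvgMr; apply: cvgB; first by apply: cvg_I; rewrite addr_gt0.
by apply: cvgMr; exact: cvg_I.
Qed.

Lemma Gamma_ge0 z : 0 <= Gamma z.
Proof. by apply: Rintegral_ge0 => t _; rewrite mulr_ge0 ?powR_ge0 ?expR_ge0. Qed.

Lemma Gamma1 : Gamma (1 : R) = 1.
Proof.
have H : (F 0 n.+2%:R^-1 - F 0 n.+2%:R) @[n --> \oo] --> F 0 0 - 0.
  apply: cvgB.
    have h0 : (n.+2%:R^-1 : R) @[n --> \oo] --> 0.
      by have := @cvg_harmonic R; rewrite -cvg_shiftS; exact.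
    (* The convention that 0 to the power 0 is 1 makes [F 0] continuous at 0. *)
    apply: (cvg_comp _ _ h0); rewrite (_ : F 0 = fun t => expR (- t)); last first.
      by apply/funext => t; rewrite /F powRr0 mul1r.
    apply: continuous_comp; first exact: opp_continuous.
    exact: continuous_expR.
  rewrite (_ : (fun n => F 0 n.+2%:R) = fun n => expR (- n.+2%:R)); last first.
    by apply/funext => n; rewrite /F powRr0 mul1r.
  by have := @cvgn_expR R; rewrite -(cvg_shiftn 2); under eq_fun do rewrite addn2.
have := cvg_I ltr01; rewrite -[in I 1](add0r 1).
have -> : (fun n => I (0 + 1) n) = (fun n => F 0 n.+2%:R^-1 - F 0 n.+2%:R).
  by apply/funext => n; have := Iparts 0 n; rewrite mul0r => h; lra.
move=> /(cvg_unique _ H) <-; rewrite // /F powRr0 oppr0 expR0; lra.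
Qed.

End gamma_function.

(** * Taylor polynomials of the exponential and Poisson tails *)

Section truncated_exponential.
Variable R : realType.
Implicit Types (t y r : R) (m n : nat).

Definition expT m y : R := \sum_(k < m) exp_coeff y k.

Let cvg_expT y : expT n y @[n --> \oo] --> expR y.
Proof.
rewrite (_ : (fun n => expT n y) = series (exp_coeff y)); last first.
  by apply/funext => n; rewrite /series /= big_mkord.
exact: is_cvg_series_exp_coeff.
Qed.

Lemma exp_coeffM t y n : exp_coeff (t * y) n = t ^+ n * exp_coeff y n.
Proof. by rewrite /exp_coeff /= exprMn mulrA. Qed.

Lemma expT_ge0 m y : 0 <= y -> 0 <= expT m y.
Proof. by move=> y0; apply: sumr_ge0 => k _; exact: exp_coeff_ge0. Qed.

Lemma expT_le m n y : 0 <= y -> (m <= n)%N -> expT m y <= expT n y.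
Proof.
move=> y0 mn; rewrite /expT -!(big_mkord xpredT (exp_coeff y)).
rewrite (big_cat_nat (leq0n m) mn)//= lerDl.
by apply: sumr_ge0 => k _; exact: exp_coeff_ge0.
Qed.

Lemma expT_le_expR m y : 0 <= y -> expT m y <= expR y.
Proof.
move=> y0; apply: (ler_cvg_to (cvg_cst (expT m y)) (@cvg_expT y)).
by near=> n; apply: expT_le => //; near: n; exact: nbhs_infty_ge.
Unshelve. all: by end_near. Qed.

Lemma exp_coeff_le_expR n y : 0 <= y -> exp_coeff y n <= expR y.
Proof.
move=> y0; apply: le_trans (expT_le_expR n.+1 y0).
by rewrite /expT big_ord_recr/= lerDr; exact: expT_ge0.
Qed.

(** Every remaining term has degree k >= m, hence carries a factor t^k <= t^m. *)
Lemma expR_sub_expT_scale m t y : 0 <= t -> t <= 1 -> 0 <= y ->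
  expR (t * y) - expT m (t * y) <= t ^+ m * (expR y - expT m y).
Proof.
move=> t0 t1 y0.
have c1 : (expT n (t * y) - expT m (t * y)) @[n --> \oo] -->
    expR (t * y) - expT m (t * y).
  by apply: cvgB; [exact: cvg_expT|exact: cvg_cst].
have c2 : (t ^+ m * (expT n y - expT m y)) @[n --> \oo] -->
    t ^+ m * (expR y - expT m y).
  by apply: cvgMr; apply: cvgB; [exact: cvg_expT|exact: cvg_cst].
apply: (ler_cvg_to c1 c2); near=> n.
have mn : (m <= n)%N by near: n; exact: nbhs_infty_ge.
rewrite /expT -!(big_mkord xpredT (exp_coeff _)).
rewrite !(big_cat_nat (leq0n m) mn)//= ![_ + \sum_(m <= _ < n) _]addrC !addrK mulr_sumr.
apply: ler_sum_nat => k /andP[mk _].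
by rewrite exp_coeffM ler_wpM2r ?exp_coeff_ge0// ler_wiXn2l.
Unshelve. all: by end_near. Qed.

Lemma expR_sub_expT_le m t y : 0 <= t -> t <= 1 -> 0 <= y ->
  expR (t * y) - expT m (t * y) <= t ^+ m * expR y.
Proof.
move=> t0 t1 y0; apply: le_trans (expR_sub_expT_scale m t0 t1 y0) _.
by rewrite ler_wpM2l ?exprn_ge0// lerBlDr lerDl expT_ge0.
Qed.

(* Chernoff bounds for a Poisson variable of mean [y]: its probability of being
   [< m] is [expR (- y) * expT m y]. *)
Lemma poisson_lt_ge m r y : 0 < r -> r <= 1 -> 0 <= y -> y <= r * m%:R ->
  1 - (r * expR (1 - r)) ^+ m <= expR (- y) * expT m y.
Proof.
move=> r0 r1 y0 yr.
have yr0 : 0 <= y / r by rewrite divr_ge0// ltW.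
have := expR_sub_expT_le m (ltW r0) r1 yr0.
rewrite mulrC divfK ?gt_eqF// -(ler_pM2l (expR_gt0 (- y))) mulrBr -expRD addNr expR0.
rewrite lerBlDr -lerBlDl => /(le_trans _); apply.
rewrite lerD2l lerN2 mulrCA exprMn ler_wpM2l ?exprn_ge0 ?(ltW r0)//.
rewrite -expRD -expRM_natr ler_expR.
have -> : - y + y / r = (y / r) * (1 - r) by field; rewrite gt_eqF.
rewrite mulrC ler_wpM2l ?subr_ge0// ler_pdivrMr//.
by rewrite mulrC.
Qed.

(** Exponential tilting: for [1 <= r], each term of degree below [m] grows by a factor at most r^m
    when [y / r] is replaced by [y]. *)
Lemma poisson_lt_le m r y : 1 <= r -> r * m%:R <= y ->
  expR (- y) * expT m y <= (r * expR (1 - r)) ^+ m.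
Proof.
move=> r1 ry.
have r0 : 0 < r by exact: lt_le_trans r1.
have y0 : 0 <= y by apply: le_trans ry; rewrite mulr_ge0// ltW.
have yr0 : 0 <= y / r by rewrite divr_ge0// ltW.
have h : expT m y <= r ^+ m * expR (y / r).
  apply: (@le_trans _ _ (r ^+ m * expT m (y / r))); last first.
    by rewrite ler_wpM2l ?exprn_ge0 ?(ltW r0)// expT_le_expR.
  rewrite -{1}(divfK (lt0r_neq0 r0) y) (mulrC _ r) /expT mulr_sumr.
  apply: ler_sum => k _; rewrite (exp_coeffM r).
  apply: ler_wpM2r; first exact: exp_coeff_ge0.
  by rewrite ler_weXn2l// ltnW.
apply: (le_trans (ler_wpM2l (expR_ge0 _) h)).
rewrite mulrCA exprMn ler_wpM2l ?exprn_ge0 ?(ltW r0)//.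
rewrite -expRD -expRM_natr ler_expR.
have -> : - y + y / r = (1 - r) * (y / r) by field; rewrite gt_eqF.
by rewrite ler_wnM2l ?subr_le0// ler_pdivlMr// mulrC.
Qed.

(** Strictness of 1 + x < exp(x) at x = r - 1; it makes both Chernoff errors decay geometrically in
    [m]. *)
Lemma mul_expR_subr_lt1 r : 0 < r -> r != 1 -> r * expR (1 - r) < 1.
Proof.
move=> r0 r1; rewrite -opprB expRN ltr_pdivrMr ?expR_gt0// mul1r.
by rewrite -[ltLHS](subrKC 1) expR_gt1Dx// subr_eq0.
Qed.

End truncated_exponential.

(** * The binomial series with a real exponent *)

Section binomial_series.
Variable R : realType.
Implicit Types (a t : R) (m n k : nat).

(* [binq a k] is the coefficient of [t ^+ k] in [(1 - t) `^ a]. *)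
Definition binq a k : R := \prod_(j < k) ((j%:R - a) / j.+1%:R).

(** The partial sums build up the Sibuya tail: by [e], each new coefficient is -a/(n+1) times the
    previous partial sum. *)
Lemma sum_binq a m : \sum_(k < m.+1) binq a k = \prod_(j < m) (1 - a / j.+1%:R).
Proof.
have e n : binq a n.+1 = - (a / n.+1%:R) * \prod_(j < n) (1 - a / j.+1%:R).
  elim: n => [|n IH].
    by rewrite /binq big_ord_recr !big_ord0/= mulr1 mul1r sub0r mulNr.
  rewrite /binq big_ord_recr/= -/(binq a n.+1) IH [in RHS]big_ord_recr/=.
  rewrite -![_.+2%:R]natr1; have k1 : n.+1%:R != 0 :> R by rewrite pnatr_eq0.
  have k2 : n.+1%:R + 1 != 0 :> R by rewrite natr1 pnatr_eq0.
  by field; rewrite nat1r k1 k2.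
elim: m => [|m IH]; first by rewrite big_ord_recr big_ord0 /binq/= !big_ord0 add0r.
by rewrite big_ord_recr/= IH e [in RHS]big_ord_recr/=; ring.
Qed.

(** Only the factor at j = 0 is negative. This sign gives the Sibuya law nonnegative weights. *)
Lemma binqS_le0 a k : 0 < a -> a < 1 -> binq a k.+1 <= 0.
Proof.
move=> a0 a1; rewrite /binq big_ord_recl/= mulr_le0_ge0//.
  by rewrite sub0r mulr_le0_ge0// oppr_le0 ltW.
apply: prodr_ge0 => j _; rewrite divr_ge0// subr_ge0 (le_trans (ltW a1))//.
by rewrite ler1n.
Qed.

Lemma binqS a k : k.+1%:R * binq a k.+1 = - a * binq (a - 1) k.
Proof.
rewrite /binq big_ord_recl/=.
transitivity (- a * (k.+1%:R * \prod_(j < k) ((j.+1%:R - a) / j.+2%:R))).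
  by rewrite sub0r divr1 mulrCA.
congr (_ * _).
elim: k => [|k IH]; first by rewrite !big_ord0 mulr1.
rewrite !big_ord_recr/= -IH -![_.+2%:R]natr1 -![_.+1%:R]natr1.
have k1 : k%:R + 1 != 0 :> R by rewrite natr1 pnatr_eq0.
have k2 : k%:R + 1 + 1 != 0 :> R by rewrite !natr1 pnatr_eq0.
by field; rewrite k1 k2.
Qed.

Definition bin_poly a m : {poly R} := \poly_(k < m) binq a k.

Lemma deriv_bin_poly a m : (bin_poly a m.+1)^`() = - a *: bin_poly (a - 1) m.
Proof.
apply/polyP => k; rewrite coef_deriv coefZ !coef_poly ltnS.
by case: ifP => km; rewrite ?mul0rn ?mulr0// -binqS mulr_natl.
Qed.

Lemma bin_poly0 a m : (bin_poly a m.+1).[0] = 1.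
Proof. by rewrite horner_coef0 coef_poly/= /binq big_ord0. Qed.

(** Induction on [m] for all real exponents at once, since differentiation lowers [a]: by the mean
    value theorem the remainder is [t] times its derivative at an intermediate point, a multiple of
    the remainder for [a - 1]. Staying below 1/2 avoids the singularity at 1. *)
Lemma binomial_taylor m a : exists2 C, 0 <= C &
  forall t, 0 <= t -> t <= 2^-1 -> `|(1 - t) `^ a - (bin_poly a m).[t]| <= C * t ^+ m.
Proof.
elim: m a => [|m IH] a.
  exists (1 + 2^-1 `^ a); first by rewrite addr_ge0// powR_ge0.
  move=> t t0 t2; rewrite expr0 mulr1 /bin_poly poly_def big_ord0 horner0 subr0.
  rewrite ger0_norm ?powR_ge0//.
  have u : 0 < 1 - t <= 1 by apply/andP; split; lra.
  have v : 0 < (2^-1 : R) <= 1 by apply/andP; split; lra.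
  have [a0|a0] := leP 0 a.
    apply: (@le_trans _ _ 1); last by rewrite lerDl powR_ge0.
    by have := ger_powR u a0; rewrite powRr0.
  apply: (@le_trans _ _ (2^-1 `^ a)); last by rewrite lerDr.
  rewrite -[a]opprK !(powRN _ (- a)) lef_pV2 ?posrE ?powR_gt0//; [|lra..].
  by rewrite ge0_ler_powR ?nnegrE; lra.
have [C C0 HC] := IH (a - 1).
exists (`|a| * C); first by rewrite mulr_ge0.
move=> t t0 t2.
pose f (x : R) := (1 - x) `^ a - (bin_poly a m.+1).[x].
pose df (x : R) : R := - a * ((1 - x) `^ (a - 1) - (bin_poly (a - 1) m).[x]).
have fd (x : R) : x < 1 -> is_derive x 1 f (df x).
  move=> x1; have x0 : 0 < 1 - x by rewrite subr_gt0.
  have d1 : is_derive x 1 (fun x : R => 1 - x) (- 1).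
    have := is_deriveB (is_derive_cst (1 : R) x 1) (is_derive_id x (1 : R)).
    by move/is_derive_eq; apply; rewrite sub0r.
  have := is_deriveB (@is_derive1_comp R (@powR R ^~ a) (fun x => 1 - x) x _ _
    (is_derive1_powR a x0) d1) (is_derive_poly (bin_poly a m.+1) x).
  move/is_derive_eq; apply; rewrite deriv_bin_poly hornerZ /df; ring.
have f0 : f 0 = 0 by rewrite /f subr0 powR1 bin_poly0 subrr.
have fdt x : x \in `]0, t[ -> is_derive x 1 f (df x).
  by rewrite in_itv/= => /andP[_ xt]; apply: fd; lra.
have fc : {within `[0, t], continuous f}.
  apply: continuous_in_subspaceT => x; rewrite inE/= in_itv/= => /andP[_ xt].
  have x1 : x < 1 by lra.
  apply: differentiable_continuous; apply/derivable1_diffP.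
  by have [] := fd x x1.
have [c + ftE] := MVT_segment t0 fdt fc.
rewrite in_itv/= => /andP[c0 ct].
move: ftE; rewrite f0 !subr0 -/(f t) => ->.
rewrite /df normrM normrM normrN (ger0_norm t0) exprSr mulrA ler_wpM2r//.
rewrite -mulrA ler_wpM2l//; apply: (le_trans (HC c c0 _)); first by lra.
by rewrite ler_wpM2l// lerXn2r ?nnegrE.
Qed.

End binomial_series.

(** * The compound Poisson law with Sibuya jumps *)

Section discrete_stable.
Variable R : realType.
Implicit Types (a t s : R) (m n k : nat) (p : {poly R}).

(** Letting t tend to 0 kills the constant coefficient; then divide by X and induct. *)
Lemma poly_bigO_coef m p (C d : R) : 0 < d ->
  (forall t, 0 < t -> t <= d -> `|p.[t]| <= C * t ^+ m) ->
  forall k, (k < m)%N -> p`_k = 0.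
Proof.
move=> d0; elim: m p C => // m IH p C H.
have d1 : 0 < Num.min d 1 by rewrite lt_min d0 ltr01.
have p0 : p`_0 = 0.
  rewrite -horner_coef0; apply/eqP; rewrite -normr_le0.
  have c1 : `|p.[t]| @[t --> 0^'+] --> `|p.[0]|.
    apply: cvg_at_right_filter; apply: cvg_norm; exact: continuous_horner.
  have c2 : C * t ^+ m.+1 @[t --> 0^'+] --> C * 0 ^+ m.+1.
    by apply: cvg_at_right_filter; apply: cvgMr; exact: exprn_continuous.
  rewrite expr0n/= mulr0 in c2.
  apply: (ler_cvg_to c1 c2); near=> t; apply: H => //.
  by near: t; exact: nbhs_right_le.
have [q pE] : exists q, p = q * 'X.
  have /factor_theorem : root p 0 by rewrite /root horner_coef0 p0.
  by rewrite subr0.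
have Hq t : 0 < t -> t <= d -> `|q.[t]| <= C * t ^+ m.
  move=> t0 td; have := H t t0 td; rewrite pE hornerMX normrM (gtr0_norm t0).
  by rewrite exprSr mulrA ler_pM2r.
move=> [|k] km; first exact: p0.
by rewrite pE coefMX/=; exact: (IH _ _ Hq).
Unshelve. all: by end_near. Qed.


Section coefficients.
Variables (a s : R) (m : nat).
Hypotheses (a0 : 0 < a) (a1 : a < 1) (s0 : 0 <= s).

(* The truncated generating function of the Sibuya law [1 - (1 - t) `^ a] and
   the corresponding truncation of [expR (s * (1 - (1 - t) `^ a))]. *)
Let H : {poly R} := 1 - bin_poly a m.+1.
Let E : {poly R} := \sum_(j < m.+1) j`!%:R^-1 *: (s *: H) ^+ j.

Let coefH k : H`_k = if k is k'.+1 then if (k' < m)%N then - binq a k else 0 else 0.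
Proof.
rewrite /H coefB coef1 coef_poly; case: k => [|k]/=.
  by rewrite /binq big_ord0 subrr.
by rewrite ltnS sub0r; case: ifP; rewrite ?oppr0.
Qed.

Let H_ge0 k : 0 <= H`_k.
Proof.
rewrite coefH; case: k => [|k]//; case: ifP => // _.
by rewrite oppr_ge0 binqS_le0.
Qed.

Let horner1_bin_poly : (bin_poly a m.+1).[1] = \sum_(k < m.+1) binq a k.
Proof. by rewrite /bin_poly horner_poly; apply: eq_bigr => i _; rewrite expr1n mulr1. Qed.

Let prod_ge0 : 0 <= \prod_(j < m) (1 - a / j.+1%:R).
Proof.
apply: prodr_ge0 => j _; rewrite subr_ge0 ler_pdivrMr// mul1r.
by rewrite (le_trans (ltW a1))// ler1n.
Qed.

Let H1 : H.[1] = 1 - \prod_(j < m) (1 - a / j.+1%:R).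
Proof. by rewrite /H hornerD hornerN hornerC horner1_bin_poly sum_binq. Qed.

Let horner_ge0 p t : 0 <= t -> (forall k, 0 <= p`_k) -> 0 <= p.[t].
Proof.
move=> t0 p0; rewrite horner_coef; apply: sumr_ge0 => i _.
by rewrite mulr_ge0 ?exprn_ge0.
Qed.

(** [H] has no constant term and nonnegative coefficients, so H(t) <= t H(1), and H(1) <= 1. *)
Let H_le t : 0 <= t -> t <= 1 -> H.[t] <= t.
Proof.
move=> t0 t1; apply: (@le_trans _ _ (t * H.[1])); last first.
  by rewrite ler_piMr// H1 lerBlDr lerDl prod_ge0.
rewrite !horner_coef mulr_sumr; apply: ler_sum => -[[|k] ki] _ /=.
  by rewrite coefH !mul0r mulr0.
rewrite expr1n mulr1 mulrC ler_wpM2r ?H_ge0// exprS ler_piMr//.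
by rewrite exprn_ile1.
Qed.

Let coef_mul_ge0 (p q : {poly R}) : (forall k, 0 <= p`_k) -> (forall k, 0 <= q`_k) ->
  forall k, 0 <= (p * q)`_k.
Proof.
by move=> p0 q0 k; rewrite coefM; apply: sumr_ge0 => j _; exact: mulr_ge0.
Qed.

Let E_term_ge0 j k : 0 <= (j`!%:R^-1 *: (s *: H) ^+ j)`_k.
Proof.
rewrite coefZ mulr_ge0 ?invr_ge0//.
elim: j k => [k|j IH]; first by rewrite expr0 coef1 ler0n.
rewrite exprS; apply: coef_mul_ge0 => // k.
by rewrite coefZ mulr_ge0.
Qed.

Let E_ge0 k : 0 <= E`_k.
Proof. by rewrite coef_sum; apply: sumr_ge0 => j _; exact: E_term_ge0. Qed.

Let hornerE t : E.[t] = expT m.+1 (s * H.[t]).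
Proof.
rewrite /E /expT horner_sum; apply: eq_bigr => j _.
by rewrite hornerZ horner_exp hornerZ /exp_coeff/= mulrC.
Qed.

Variable u : nat -> R.
Hypothesis gen_u : forall t, 0 <= t -> t <= 1 ->
  `|\sum_(k < m.+1) u k * t ^+ k - expR (- (s * (1 - t) `^ a))| <= t ^+ m.+1.

(** Although [gen_u] is only approximate, an error of order t^(m+1) cannot affect coefficients up to
    [m]. Three such errors are added: the one in [gen_u], that of the truncated binomial series, and
    that of the truncated exponential. *)
Let u_coef k : (k <= m)%N -> u k = expR (- s) * E`_k.
Proof.
move=> km.
pose U : {poly R} := \poly_(k < m.+1) u k.
suff : (expR s *: U - E)`_k = 0.
  rewrite coefB coefZ coef_poly ltnS km => /eqP; rewrite subr_eq0 => /eqP <-.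
  by rewrite mulrA -expRD addNr expR0 mul1r.
have [C C0 HC] := binomial_taylor m.+1 a.
apply: (@poly_bigO_coef m.+1 _ (expR s + expR s * (s * C) + expR s) 2^-1);
  last by rewrite ltnS.
  by rewrite invr_gt0.
move=> t /ltW t0 t2; have t1 : t <= 1 by lra.
have Ht0 : 0 <= H.[t] by apply: horner_ge0.
have Ht1 := H_le t0 t1.
set h := 1 - (1 - t) `^ a.
have h0 : 0 <= h.
  rewrite subr_ge0.
  have := @ge0_ler_powR _ _ (ltW a0) (1 - t) 1; rewrite !nnegrE powR1; apply; lra.
have h1 : h <= 1 by rewrite lerBlDr lerDl powR_ge0.
have b1 : `|expR s * U.[t] - expR (s * h)| <= expR s * t ^+ m.+1.
  have -> : expR (s * h) = expR s * expR (- (s * (1 - t) `^ a)).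
    by rewrite -expRD; congr expR; rewrite /h; ring.
  rewrite -mulrBr normrM (gtr0_norm (expR_gt0 _)) ler_wpM2l ?expR_ge0//.
  by rewrite horner_poly; exact: gen_u.
have b2 : `|expR (s * h) - expR (s * H.[t])| <= expR s * (s * C) * t ^+ m.+1.
  have lip x y : 0 <= x -> x <= s -> 0 <= y -> y <= s ->
      expR x - expR y <= expR s * `|x - y|.
    move=> x0 xs y0 ys; apply: (@le_trans _ _ (expR x * (x - y))).
      have := ler_wpM2l (expR_ge0 x) (expR_ge1Dx (y - x)).
      by rewrite -expRD subrKC; lra.
    apply: (@le_trans _ _ (expR x * `|x - y|)).
      by rewrite ler_wpM2l ?expR_ge0// ler_norm.
    by rewrite ler_wpM2r// ler_expR.
  have sh z : 0 <= z -> z <= 1 -> 0 <= s * z /\ s * z <= s.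
    by move=> z0 z1; rewrite mulr_ge0// ler_piMr.
  have [x0 x1] := sh _ h0 h1.
  have [y0 y1] := sh _ Ht0 (le_trans Ht1 t1).
  apply: (@le_trans _ _ (expR s * `|s * h - s * H.[t]|)).
    rewrite ler_norml; apply/andP; split; last exact: lip.
    by rewrite lerNl opprB distrC; exact: lip.
  rewrite -!mulrA ler_wpM2l ?expR_ge0// -mulrBr normrM (ger0_norm s0) ler_wpM2l//.
  rewrite /H hornerD hornerN hornerC /h.
  rewrite (_ : 1 - _ - _ = - ((1 - t) `^ a - (bin_poly a m.+1).[t])); last by ring.
  by rewrite normrN; exact: HC.
have b3 : `|expR (s * H.[t]) - E.[t]| <= expR s * t ^+ m.+1.
  rewrite hornerE ger0_norm ?subr_ge0 ?expT_le_expR ?mulr_ge0//.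
  have [->|tn0] := eqVneq t 0.
    have -> : H.[0] = 0 by rewrite horner_coef0 coefH.
    rewrite mulr0 expR0 /expT big_ord_recl big1 => [|i _].
      by rewrite /exp_coeff/= expr0 divr1 addr0 subrr mulr_ge0 ?expR_ge0 ?exprn_ge0.
    by rewrite /exp_coeff/= exprS !mul0r.
  have tgt0 : 0 < t by rewrite lt_neqAle eq_sym tn0.
  (* As H(t) <= t, the argument s H(t) is [t] times a number at most [s], so the exponential
     remainder is of order t^(m+1). *)
  have v0 : 0 <= s * H.[t] / t by rewrite divr_ge0// mulr_ge0.
  have := expR_sub_expT_le m.+1 t0 t1 v0.
  rewrite mulrC divfK// => /le_trans; apply.
  rewrite mulrC ler_wpM2r ?exprn_ge0// ler_expR ler_pdivrMr//.
  by rewrite ler_wpM2l.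
rewrite hornerD hornerN hornerZ.
have -> : expR s * U.[t] - E.[t] = (expR s * U.[t] - expR (s * h)) +
   ((expR (s * h) - expR (s * H.[t])) + (expR (s * H.[t]) - E.[t])) by ring.
apply: (le_trans (ler_normD _ _)).
apply: (le_trans (lerD b1 (le_trans (ler_normD _ _) (lerD b2 b3)))).
by rewrite le_eqVlt; apply/orP; left; apply/eqP; ring.
Qed.

Let sum_coef_le p n : (forall k, 0 <= p`_k) -> \sum_(k < n) p`_k <= p.[1].
Proof.
move=> p0.
have h : p.[1] = \sum_(k < maxn n (size p)) p`_k.
  rewrite (horner_coef_wide _ (leq_maxr n (size p))).
  by apply: eq_bigr => i _; rewrite expr1n mulr1.
rewrite h -!(big_mkord xpredT (fun k => p`_k)).
rewrite (big_cat_nat (leq0n n) (leq_maxl n (size p)))//= lerDl.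
exact: sumr_ge0.
Qed.

(** All coefficients of [E] are nonnegative, so the partial sum is at most E(1) <= exp(s H(1)),
    where 1 - H(1) is the Sibuya tail. *)
Lemma discrete_stable_cdf_le :
  \sum_(k < m.+1) u k <= expR (- (s * \prod_(j < m) (1 - a / j.+1%:R))).
Proof.
have -> : \sum_(k < m.+1) u k = expR (- s) * \sum_(k < m.+1) E`_k.
  by rewrite mulr_sumr; apply: eq_bigr => k _; rewrite u_coef// -ltnS.
apply: (@le_trans _ _ (expR (- s) * E.[1])).
  by rewrite ler_wpM2l ?expR_ge0//; apply: sum_coef_le.
apply: (@le_trans _ _ (expR (- s) * expR (s * H.[1]))).
  rewrite ler_wpM2l ?expR_ge0// hornerE expT_le_expR// mulr_ge0//.
  exact: horner_ge0.
by rewrite -expRD ler_expR H1; lra.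
Qed.

(** Only the terms j = 0 and j = 1 of [E] are kept; [0 < m] ensures that both occur. Their sum has
    degree at most [m], so its coefficients add up to its value at 1. *)
Lemma discrete_stable_cdf_ge : (0 < m)%N ->
  expR (- s) * (1 + s * (1 - \prod_(j < m) (1 - a / j.+1%:R))) <= \sum_(k < m.+1) u k.
Proof.
move=> m0.
have -> : \sum_(k < m.+1) u k = expR (- s) * \sum_(k < m.+1) E`_k.
  by rewrite mulr_sumr; apply: eq_bigr => k _; rewrite u_coef// -ltnS.
rewrite ler_wpM2l ?expR_ge0// -H1.
pose E2 : {poly R} := 1 + s *: H.
have sE : (size E2 <= m.+1)%N.
  rewrite (leq_trans (size_polyD _ _))// geq_max size_poly1/=.
  rewrite (leq_trans (size_scale_leq _ _))// (leq_trans (size_polyD _ _))//.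
  by rewrite geq_max size_poly1 size_polyN size_poly.
have -> : 1 + s * H.[1] = E2.[1] 
  by rewrite [RHS]hornerD hornerZ; congr (_ + _); rewrite (hornerC 1 1).
have EE k : E2`_k <= E`_k.
  rewrite /E -(prednK m0) 2!big_ord_recl/= !invr1 !scale1r expr0 expr1 addrA -/E2.
  by rewrite [leRHS]coefD lerDl coef_sum; apply: sumr_ge0 => j _; exact: E_term_ge0.
by rewrite (horner_coef_wide _ sE); apply: ler_sum => k _; rewrite expr1n mulr1.
Qed.

End coefficients.

End discrete_stable.

(** * Expectations of functions of the stable variable *)

Section laplace.
Context d (T : measurableType d) (R : realType) (P : probability T R).
Variables (alpha : R) (Z : {RV P >-> R}).
Hypotheses (alpha_gt0 : 0 < alpha) (alpha_lt1 : alpha < 1).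
Hypothesis stableZ : positive_stable P alpha Z.
Implicit Types (f g : R -> R) (x y t r : R).

(* [Z] is only almost surely positive; [`|Z|] is everywhere nonnegative. *)
Let Ef g : R := Rintegral P setT (fun w => g `|Z w|).

Let adm g := measurable_fun setT g /\ exists M : R, forall y, 0 <= y -> `|g y| <= M.

Let measurable_normZ : measurable_fun setT (fun w => `|Z w|).
Proof. exact: measurableT_comp. Qed.

Let integrable_adm g : adm g -> P.-integrable setT (EFin \o (fun w => g `|Z w|)).
Proof.
move=> [mg [M gM]]; apply: measurable_bounded_integrable => //.
- exact: le_lt_trans (probability_le1 P measurableT) (ltry 1).
- exact: (measurableT_comp mg measurable_normZ).
- exists M; split; first exact: num_real.
  by move=> x Mx w _ /=; rewrite (le_trans _ (ltW Mx))// gM.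
Qed.

Let Ef_le f g : adm f -> adm g -> (forall y, 0 <= y -> f y <= g y) -> Ef f <= Ef g.
Proof.
move=> af ag fg; apply: le_Rintegral => //; [exact: integrable_adm..|].
by move=> w _; exact: fg.
Qed.

Let EfD f g : adm f -> adm g -> Ef (fun y => f y + g y) = Ef f + Ef g.
Proof. by move=> af ag; apply: RintegralD => //; exact: integrable_adm. Qed.

Let EfZ c f : adm f -> Ef (fun y => c * f y) = c * Ef f.
Proof. by move=> af; apply: RintegralZl => //; exact: integrable_adm. Qed.

Let Ef_cst c : Ef (fun=> c) = c.
Proof.
have PT : (P : {measure set T -> \bar R}) setT = 1%E := probability_setT P.
by rewrite /Ef Rintegral_cst// PT mulr1.
Qed.

Let adm_cst c : adm (fun=> c).
Proof. by split; [exact: measurable_cst|exists `|c|]. Qed.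

Let admD f g : adm f -> adm g -> adm (fun y => f y + g y).
Proof.
move=> [mf [M fM]] [mg [N gN]]; split; first exact: measurable_funD.
by exists (M + N) => y y0; rewrite (le_trans (ler_normD _ _))// lerD ?fM ?gN.
Qed.

Let admZ c f : adm f -> adm (fun y => c * f y).
Proof.
move=> [mf [M fM]]; split; first exact: measurable_funM.
by exists (`|c| * M) => y y0; rewrite normrM ler_wpM2l// fM.
Qed.

Let adm_sum n (f : nat -> R -> R) : (forall i, adm (f i)) ->
  adm (fun y => \sum_(i < n) f i y).
Proof.
move=> af; elim: n => [|n IH].
  by under eq_fun do rewrite big_ord0; exact: adm_cst.
by under eq_fun do rewrite big_ord_recr/=; exact: admD.
Qed.

Let Ef_sum n (f : nat -> R -> R) : (forall i, adm (f i)) ->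
  Ef (fun y => \sum_(i < n) f i y) = \sum_(i < n) Ef (f i).
Proof.
move=> af; elim: n => [|n IH].
  by rewrite big_ord0 -[RHS]Ef_cst; congr Ef; apply/funext => y; rewrite big_ord0.
rewrite big_ord_recr/= -IH -EfD//; last exact: adm_sum.
by congr Ef; apply/funext => y; rewrite big_ord_recr.
Qed.

Let Ef_integral g : measurable_fun setT g ->
  Ef g = fine (\int[P]_w (g (Z w))%:E)%E.
Proof.
move=> mg; congr fine; apply: ae_eq_integral => //.
- by apply/measurable_EFinP; exact: (measurableT_comp mg measurable_normZ).
- by apply/measurable_EFinP; exact: (measurableT_comp mg).
- case: stableZ => + _; apply: filterS => w Zw _ /=.
  by rewrite gtr0_norm.
Qed.

Let adm_exp l : 0 <= l -> adm (fun y => expR (- (l * y))).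
Proof.
move=> l0; split.
  apply: measurableT_comp => //; apply: measurableT_comp; first exact: oppr_measurable.
  exact: mulrl_measurable.
exists 1 => y y0; rewrite ger0_norm ?expR_ge0// expR_le1 oppr_le0.
exact: mulr_ge0.
Qed.

Let Ef_exp l : 0 <= l -> Ef (fun y => expR (- (l * y))) = expR (- (l `^ alpha)).
Proof.
move=> l0; rewrite Ef_integral; last by case: (adm_exp l0).
by case: stableZ => _ /(_ l l0); rewrite unlock => ->.
Qed.

Let adm_ind x : adm (fun y => (x <= y)%R%:R).
Proof.
split; last by exists 1 => y _; case: (x <= y); rewrite ?normr1 ?normr0.
rewrite (_ : (fun y : R => _) = \1_(`[x, +oo[%classic : set R)).
  exact: measurable_indic.
by apply/funext => y; rewrite indicE mem_setE in_itv/= andbT.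
Qed.

Definition tail x : R := fine (P [set w | x <= Z w]).

Let Ef_ind x : Ef (fun y => (x <= y)%R%:R) = tail x.
Proof.
rewrite Ef_integral; last by case: (adm_ind x).
congr fine; have mA : measurable [set w | x <= Z w].
  have -> : [set w | x <= Z w] = Z @^-1` `[x, +oo[.
    by apply/seteqP; split => w /=; rewrite in_itv/= andbT.
  exact: measurable_funPTI.
rewrite -[in RHS](setIT [set w | x <= Z w]) -integral_indic//.
by apply: eq_integral => w _; rewrite indicE mem_setE.
Qed.

(** Expectation of the pointwise bound 1 - exp(l (x - y)) <= 1_{x <= y}. *)
Lemma tail_ge_chernoff x l : 0 <= l -> 1 - expR (l * x - l `^ alpha) <= tail x.
Proof.
move=> l0; rewrite -Ef_ind expRD -(Ef_exp l0).
have ae := adm_exp l0.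
rewrite -{1}(Ef_cst 1) -mulN1r mulrA -EfZ// -EfD//; last exact: admZ.
apply: Ef_le; [by apply: admD => //; exact: admZ|exact: adm_ind|].
move=> y y0; rewrite mulN1r mulNr -expRD -mulrBr.
have [xy|yx] := leP x y; first by rewrite lerBlDr lerDl expR_ge0.
by rewrite subr_le0 -[leLHS]expR0 ler_expR mulr_ge0// subr_ge0 ltW.
Qed.

(** Induction on the number of grid points: if [y] lies beyond the new point, the value there
    suffices; otherwise the old final term becomes the new summand. *)
Let exp_staircase l h y n : 0 <= l -> 0 <= y ->
  expR (- (l * y)) <= expR (- (l * (n%:R * h))) +
    \sum_(i < n) expR (- (l * (i%:R * h))) * (1 - (i.+1%:R * h <= y)%R%:R).
Proof.
move=> l0 y0; elim: n => [|n IH].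
  rewrite big_ord0 addr0 mul0r mulr0 oppr0 expR0 expR_le1 oppr_le0.
  exact: mulr_ge0.
have nn m : 0 <=
    \sum_(i < m) expR (- (l * (i%:R * h))) * (1 - (i.+1%:R * h <= y)%R%:R) :> R.
  apply: sumr_ge0 => i _; rewrite mulr_ge0 ?expR_ge0// subr_ge0.
  by rewrite lern1 leq_b1.
have [hy|hy] := leP (n.+1%:R * h) y.
  apply: (@le_trans _ _ (expR (- (l * (n.+1%:R * h))))).
    by rewrite ler_expR lerN2 ler_wpM2l.
  by rewrite lerDl nn.
apply: (le_trans IH); rewrite big_ord_recr/= (leNgt _ y) hy/= subr0 mulr1.
by have := expR_ge0 (- (l * (n.+1%:R * h))); lra.
Qed.

Lemma laplace_le_staircase l h n : 0 <= l ->
  expR (- (l `^ alpha)) <= expR (- (l * (n%:R * h))) +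
    \sum_(i < n) expR (- (l * (i%:R * h))) * (1 - tail (i.+1%:R * h)).
Proof.
move=> l0; rewrite -Ef_exp// -[X in _ <= X + _]Ef_cst.
have ai x : adm (fun y => 1 - (x <= y)%R%:R).
  by have := admD (adm_cst 1) (admZ (-1) (adm_ind x)); under eq_fun do rewrite mulN1r.
have tE x : 1 - tail x = Ef (fun y => 1 - (x <= y)%R%:R).
  rewrite -Ef_ind -{1}(Ef_cst 1) -mulN1r -EfZ// -EfD//; last exact: admZ.
  by congr Ef; apply/funext => y; rewrite mulN1r.
under eq_bigr do rewrite tE -EfZ//.
pose step i y := expR (- (l * (i%:R * h))) * (1 - (i.+1%:R * h <= y)%R%:R).
have a_step i : adm (step i) by exact: admZ.
have a_sum := @adm_sum n step a_step.
rewrite -(@Ef_sum n step a_step).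
rewrite -EfD//; apply: Ef_le; [exact: adm_exp|exact: admD|].
by move=> y y0; exact: exp_staircase.
Qed.

(** * A Poisson variable of random mean [l * Z] *)

Section poissonization.
Variables (l : R) (n : nat).
Hypothesis l0 : 0 <= l.
Local Notation m := n.+1.

(* [u k] is the probability that a Poisson variable of random mean [l * Z]
   takes the value [k]. *)
Let weight k y := expR (- (l * y)) * exp_coeff (l * y) k.
Let u k := Ef (weight k).

Let adm_weight k : adm (weight k).
Proof.
split.
  apply: measurable_funM; first by case: (adm_exp l0).
  apply: measurable_funM => //; apply: measurable_funX.
  exact: mulrl_measurable.
exists 1 => y y0; have ly0 : 0 <= l * y by exact: mulr_ge0.
rewrite /weight ger0_norm ?mulr_ge0 ?expR_ge0 ?exp_coeff_ge0//.
by rewrite expRN mulrC ler_pdivrMr ?expR_gt0// mul1r exp_coeff_le_expR.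
exact: exprn_ge0.
Qed.

Let sum_u t : \sum_(k < m) u k * t ^+ k =
  Ef (fun y => expR (- (l * y)) * expT m (t * (l * y))).
Proof.
transitivity (\sum_(k < m) Ef (fun y => t ^+ k * weight k y)).
  by apply: eq_bigr => k _; rewrite (EfZ _ (adm_weight k)) mulrC.
rewrite -(@Ef_sum m (fun k y => t ^+ k * weight k y)) => [|k];
  last exact: (admZ _ (adm_weight k)).
congr Ef; apply/funext => y; rewrite /expT mulr_sumr; apply: eq_bigr => k _.
by rewrite exp_coeffM /weight mulrCA.
Qed.

Let adm_expT t : adm (fun y => expR (- (l * y)) * expT m (t * (l * y))).
Proof.
rewrite (_ : (fun _ => _) = fun y => \sum_(k < m) t ^+ k * weight k y); last first.
  apply/funext => y; rewrite /expT mulr_sumr; apply: eq_bigr => k _.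
  by rewrite exp_coeffM /weight mulrCA.
by apply: (@adm_sum m (fun k y => t ^+ k * weight k y)) => k; exact: (admZ _ (adm_weight k)).
Qed.

(** The full generating function is E exp(-l (1-t) Z); cutting the exponential series after degree
    [n] costs between 0 and t^(n+1) pointwise. *)
Let poissonized_gen t : 0 <= t -> t <= 1 ->
  `|\sum_(k < m) u k * t ^+ k - expR (- (l `^ alpha * (1 - t) `^ alpha))| <= t ^+ m.
Proof.
move=> t0 t1; have t1' : 0 <= 1 - t by rewrite subr_ge0.
have lt0 : 0 <= l * (1 - t) by exact: mulr_ge0.
rewrite sum_u -powRM// -Ef_exp// distrC -[X in _ - X]mul1r -mulNr -EfZ; last exact: adm_expT.
have a1 := admZ (-1) (adm_expT t).
rewrite -EfD//; last exact: adm_exp.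
have key y : 0 <= y -> 0 <= expR (- (l * (1 - t) * y)) +
     -1 * (expR (- (l * y)) * expT m (t * (l * y))) <= t ^+ m.
  move=> y0; have ly0 : 0 <= l * y by exact: mulr_ge0.
  have -> : expR (- (l * (1 - t) * y)) = expR (- (l * y)) * expR (t * (l * y)).
    by rewrite -expRD; congr expR; ring.
  rewrite mulN1r -mulrBr; apply/andP; split.
    by rewrite mulr_ge0 ?expR_ge0// subr_ge0 expT_le_expR// mulr_ge0.
  have := ler_wpM2l (expR_ge0 (- (l * y))) (expR_sub_expT_le m t0 t1 ly0).
  by move=> /le_trans; apply; rewrite mulrCA -expRD addNr expR0 mulr1.
rewrite ger0_norm.
  rewrite -[leRHS]Ef_cst; apply: Ef_le; [by apply: admD => //; exact: adm_exp|exact: adm_cst|].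
  by move=> y /key/andP[].
rewrite -[leLHS](Ef_cst 0); apply: Ef_le; [exact: adm_cst|by apply: admD => //; exact: adm_exp|].
by move=> y /key/andP[].
Qed.

Let sum_u1 : \sum_(k < m) u k = Ef (fun y => expR (- (l * y)) * expT m (1 * (l * y))).
Proof. by rewrite -sum_u; apply: eq_bigr => k _; rewrite expr1n mulr1. Qed.

(** Where Z < x the Poisson mean is below [r * m], so Chernoff's bound applies; elsewhere the
    conditional probability is bounded below by 0. *)
Let poissonized_cdf_ge x r : 0 < r -> r <= 1 -> l * x = r * m%:R ->
  (1 - (r * expR (1 - r)) ^+ m) * (1 - tail x) <= \sum_(k < m) u k.
Proof.
move=> r0 r1 lx; set c := 1 - _.
have c0 : 0 <= c.
  rewrite subr_ge0 exprn_ile1 ?mulr_ge0 ?expR_ge0 ?(ltW r0)//.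
  have [->|rn1] := eqVneq r 1; first by rewrite subrr expR0 mulr1.
  by rewrite ltW// mul_expR_subr_lt1.
have aI := admZ (-c) (adm_ind x).
rewrite mulrBr mulr1 -Ef_ind -{1}(Ef_cst c) -mulNr -EfZ// -EfD// sum_u1.
apply: Ef_le; [exact: admD|exact: adm_expT|].
move=> y y0; have ly0 : 0 <= l * y by exact: mulr_ge0.
have [xy|yx] := leP x y.
  by rewrite mulr1 subrr mulr_ge0 ?expR_ge0 ?expT_ge0// mul1r.
rewrite mulr0 addr0 mul1r; apply: poisson_lt_ge => //.
by rewrite -lx ler_wpM2l// ltW.
Qed.

(** Where Z >= x the Poisson mean is at least [r * m]; elsewhere the conditional probability is
    bounded by 1. *)
Let poissonized_cdf_le x r : 1 <= r -> l * x = r * m%:R ->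
  \sum_(k < m) u k <= 1 - (1 - (r * expR (1 - r)) ^+ m) * tail x.
Proof.
move=> r1 lx; set c := 1 - _ ^+ m.
have aI := admZ (-c) (adm_ind x).
rewrite -Ef_ind -{1}(Ef_cst 1) -mulNr -EfZ// -EfD// sum_u1.
apply: Ef_le; [exact: adm_expT|exact: admD|].
move=> y y0; have ly0 : 0 <= l * y by exact: mulr_ge0.
rewrite mul1r; have [xy|yx] := leP x y.
  rewrite mulr1 /c opprB subrKC; apply: poisson_lt_le => //.
  by rewrite -lx ler_wpM2l.
rewrite mulr0 addr0 expRN mulrC ler_pdivrMr ?expR_gt0// mul1r.
exact: expT_le_expR.
Qed.

Lemma tail_poissonized_ge x r : 0 < r -> r <= 1 -> l * x = r * n.+1%:R ->
  (1 - (r * expR (1 - r)) ^+ n.+1) * (1 - tail x) <=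
  expR (- (l `^ alpha * \prod_(j < n) (1 - alpha / j.+1%:R))).
Proof.
move=> r0 r1 lx; apply: le_trans (poissonized_cdf_ge r0 r1 lx) _.
exact: (discrete_stable_cdf_le alpha_gt0 alpha_lt1 (powR_ge0 l alpha) poissonized_gen).
Qed.

Lemma tail_poissonized_le x r : (0 < n)%N -> 1 <= r -> l * x = r * n.+1%:R ->
  expR (- (l `^ alpha)) * (1 + l `^ alpha * (1 - \prod_(j < n) (1 - alpha / j.+1%:R))) <=
  1 - (1 - (r * expR (1 - r)) ^+ n.+1) * tail x.
Proof.
move=> n0 r1 lx; apply: le_trans _ (poissonized_cdf_le r1 lx).
exact: (discrete_stable_cdf_ge alpha_gt0 alpha_lt1 (powR_ge0 l alpha) poissonized_gen).
Qed.

End poissonization.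

End laplace.

(** * Two-sided bounds on the Sibuya tail *)

Section sibuya_tail.
Variables (R : realType) (a : R).
Hypotheses (a0 : 0 < a) (a1 : a < 1).
Let w m : R := \prod_(j < m) (1 - a / j.+1%:R).

Lemma Gamma_nat n : Gamma (n.+1%:R : R) = n`!%:R.
Proof.
elim: n => [|n IH]; first by rewrite fact0 Gamma1.
by rewrite -natr1 GammaD1// IH factS natrM.
Qed.

Lemma Gamma_sibuya m : w m * Gamma (1 - a) * m`!%:R = Gamma (m.+1%:R - a).
Proof.
elim: m => [|m IH]; first by rewrite /w big_ord0 fact0 mulr1 mul1r.
have m1 : m.+1%:R != 0 :> R by rewrite pnatr_eq0.
have ma : 0 < m.+1%:R - a by rewrite subr_gt0 (lt_le_trans a1)// ler1n.
rewrite -[m.+2%:R]natr1 addrAC GammaD1// -IH factS natrM /w big_ord_recr/=.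
by field; rewrite nat1r.
Qed.

(** Jensen's inequality from 1 - a to 1 gives 1 <= (1-a)^a Gamma(1-a), which rules out 0. *)
Lemma Gamma_onem_gt0 : 0 < Gamma (1 - a).
Proof.
have a1' : 0 < 1 - a by rewrite subr_gt0.
have := GammaD_le a1' a0 a1; rewrite subrK Gamma1 => h.
rewrite lt_neqAle Gamma_ge0 andbT eq_sym; apply/eqP => G0.
by move: h; rewrite G0 mulr0 ler10.
Qed.

(** Jensen's inequality from m+1-a to m+1, after which the base m+1-a is enlarged to m+1. *)
Lemma sibuya_tail_ge m : m.+1%:R `^ (- a) <= w m * Gamma (1 - a).
Proof.
have ma : 0 < m.+1%:R - a by rewrite subr_gt0 (lt_le_trans a1)// ler1n.
have := GammaD_le ma a0 a1.
have f0 : 0 < m`!%:R :> R by rewrite ltr0n fact_gt0.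
rewrite subrK Gamma_nat -Gamma_sibuya mulrA -{1}[m`!%:R]mul1r ler_pM2r// => h.
have W0 : 0 <= w m * Gamma (1 - a).
  have := Gamma_ge0 (m.+1%:R - a); rewrite -Gamma_sibuya.
  by rewrite pmulr_lge0.
rewrite powRN -div1r ler_pdivrMr ?powR_gt0// mulrC.
apply: (le_trans h); rewrite ler_wpM2r//.
by rewrite ge0_ler_powR ?nnegrE ?(ltW a0) ?(ltW ma)// gerBl ltW.
Qed.

(** Jensen's inequality from m+1 to m+2-a, together with the functional equation at m+1-a. *)
Lemma sibuya_tail_le m :
  (m.+1%:R - a) * (w m * Gamma (1 - a)) <= m.+1%:R `^ (1 - a).
Proof.
have ma : 0 < m.+1%:R - a by rewrite subr_gt0 (lt_le_trans a1)// ler1n.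
have a1' : 0 < 1 - a by rewrite subr_gt0.
have a0' : 1 - a < 1 by rewrite gtrBl.
have := @GammaD_le _ m.+1%:R _ (ltr0Sn _ _) a1' a0'.
have f0 : 0 < m`!%:R :> R by rewrite ltr0n fact_gt0.
rewrite Gamma_nat addrCA addrC GammaD1// -Gamma_sibuya mulrA ler_pM2r//.
Qed.

End sibuya_tail.

(** * The two tail bounds and their optimality *)

Section tail_bounds.
Context d (T : measurableType d) (R : realType) (P : probability T R).
Variables (alpha : R) (Z : {RV P >-> R}).
Hypotheses (alpha_gt0 : 0 < alpha) (alpha_lt1 : alpha < 1).
Hypothesis stableZ : positive_stable P alpha Z.
Implicit Types (x c l s : R).
Local Notation tail := (tail Z).
Local Notation beta := (alpha / (1 - alpha)).
Local Notation g := (Gamma (1 - alpha)).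

Let onem_gt0 : 0 < 1 - alpha. Proof. by rewrite subr_gt0. Qed.

Let alpha_neq0 : alpha != 0. Proof. by rewrite gt_eqF. Qed.

Let onem_neq0 : 1 - alpha != 0. Proof. by rewrite gt_eqF. Qed.

(** The value of l x at the minimizer l = (alpha/x)^(1/(1-alpha)) of l x - l^alpha; [powN] gives
    l^alpha there. *)
Let invN x : 0 < x -> (alpha / x) `^ (1 - alpha)^-1 * x = alpha * (alpha / x) `^ beta.
Proof.
move=> x0; have b0 : 0 < alpha / x by rewrite divr_gt0.
rewrite (_ : _ `^ (1 - alpha)^-1 = (alpha / x) `^ beta * (alpha / x)).
  by field; rewrite gt_eqF.
transitivity ((alpha / x) `^ beta * (alpha / x) `^ 1); last by rewrite powRr1// ltW.
rewrite -powRD; last by apply/implyP => _; rewrite gt_eqF.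
by congr (_ `^ _); field.
Qed.

Let powN x : ((alpha / x) `^ (1 - alpha)^-1) `^ alpha = (alpha / x) `^ beta.
Proof. by rewrite -powRrM [(1 - alpha)^-1 * _]mulrC. Qed.

(* Young's inequality, with equality at [l = (alpha / x) `^ (1 - alpha)^-1]. *)
Let young x l : 0 < x -> 0 <= l ->
  l `^ alpha <= l * x + (1 - alpha) * (alpha / x) `^ beta.
Proof.
move=> x0 l0; have b0 : 0 < alpha / x by rewrite divr_gt0.
set r := (alpha / x) `^ (1 - alpha)^-1.
have r0 : 0 < r by exact: powR_gt0.
have := powR_le_tangent alpha_gt0 alpha_lt1 r0 l0.
have -> : alpha * r `^ (alpha - 1) = x.
  rewrite /r -powRrM (_ : (1 - alpha)^-1 * (alpha - 1) = -1); last by field.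
  by rewrite powR_inv1 ?(ltW b0)//; field; rewrite gt_eqF.
rewrite powN => /le_trans; apply.
by rewrite mulrBr (mulrC x r) invN//; lra.
Qed.

Lemma tail_ge_small x : 0 < x ->
  1 - expR (- ((1 - alpha) * (alpha / x) `^ beta)) <= tail x.
Proof.
move=> x0; have := tail_ge_chernoff stableZ x (powR_ge0 (alpha / x) (1 - alpha)^-1).
rewrite powN invN// (_ : alpha * _ - _ = - ((1 - alpha) * (alpha / x) `^ beta))//.
by ring.
Qed.

Lemma tail_ge_small_optimal c : 1 < c ->
  ~ (forall x, 0 < x ->
       1 - expR (- ((1 - alpha) * (alpha / (x / c)) `^ beta)) <= tail x).
Proof.
move=> c1 H; have c0 : 0 < c by exact: lt_trans c1.
have key s N : 0 < s -> (0 < N)%N ->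
    expR (- s) <= expR (- (2 * s)) + N%:R * expR (2 * s / N%:R - c `^ alpha * s).
  move=> s0 N0; have NR0 : 0 < N%:R :> R by rewrite ltr0n.
  pose l := s `^ alpha^-1.
  have l0 : 0 < l by exact: powR_gt0.
  have lE : l `^ alpha = s by rewrite /l -powRrM mulVf// powRr1// ltW.
  (* The grid ends at 2 s / l, so the final term of the staircase is exp(-2 s). *)
  pose h := 2 * s / (N%:R * l).
  have h0 : 0 < h by rewrite divr_gt0 ?mulr_gt0.
  have lh : l * h = 2 * s / N%:R by rewrite /h; field; rewrite !gt_eqF.
  have := laplace_le_staircase stableZ h N (ltW l0); rewrite lE => /le_trans; apply.
  have -> : l * (N%:R * h) = 2 * s by rewrite mulrCA lh; field; rewrite gt_eqF.
  have <- : \sum_(i < N) expR (2 * s / N%:R - c `^ alpha * s) =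
      N%:R * expR (2 * s / N%:R - c `^ alpha * s).
    by rewrite sumr_const card_ord [RHS]mulr_natl.
  rewrite lerD2l.
  apply: ler_sum => i _.
  have x0 : 0 < i.+1%:R * h by rewrite mulr_gt0.
  have xc0 : 0 < i.+1%:R * h / c by rewrite divr_gt0.
  have cl0 : 0 <= c * l by rewrite mulr_ge0// ltW.
  (* Young's inequality with [l] multiplied and the point divided by [c]: their product is unchanged
     while the power gains c^alpha. *)
  have Y := young xc0 cl0; rewrite powRM ?(ltW c0) ?(ltW l0)// lE in Y.
  have t1 : 1 - tail (i.+1%:R * h) <= expR (l * (i.+1%:R * h) - c `^ alpha * s).
    have := H _ x0; set e := expR _ => h1.
    apply: (@le_trans _ _ e); first by lra.
    rewrite ler_expR.
    have cE : c * l * (i.+1%:R * h / c) = l * (i.+1%:R * h) by field; rewrite gt_eqF.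
    by rewrite cE in Y; lra.
  apply: (le_trans (ler_wpM2l (expR_ge0 _) t1)).
  rewrite -expRD ler_expR -lh -natr1 le_eqVlt; apply/orP; left; apply/eqP; ring.
have ca1 : 1 < c `^ alpha.
  have := @gt0_ltr_powR _ _ alpha_gt0 1 c; rewrite !nnegrE powR1; apply => //.
  exact: ltW.
(* With c^alpha = 1 + 2 eta and 2/N <= eta, each step contributes at most exp(-s - eta s). *)
set eta := (c `^ alpha - 1) / 2.
have eta0 : 0 < eta by rewrite divr_gt0// subr_gt0.
pose N := (Num.truncn (2 / eta)).+1.
have NR0 : 0 < N%:R :> R by rewrite ltr0n.
have N2 : 2 / N%:R <= eta.
  rewrite ler_pdivrMr// mulrC -ler_pdivrMr//.
  by apply: ltW; exact: truncnS_gt.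
(* The summand 2 gives exp(-2 s) < exp(-s)/2; the other makes eta s exceed 2 N, so that N exp(-eta
   s) < 1/2. *)
pose s := 2 + 2 * N%:R / eta.
have Ne0 : 0 < 2 * N%:R / eta by rewrite divr_gt0// mulr_gt0.
have s0 : 0 < s by rewrite /s; lra.
have := key s N s0 isT; rewrite leNgt => /negP; apply.
have e1 : expR (- (2 * s)) < expR (- s) / 2.
  rewrite (_ : - (2 * s) = - s + - s); last by ring.
  rewrite expRD ltr_pM2l ?expR_gt0// expRN ltf_pV2 ?posrE ?expR_gt0//.
  by apply: lt_le_trans (expR_ge1Dx _); rewrite /s; lra.
have e2 : N%:R * expR (2 * s / N%:R - c `^ alpha * s) < expR (- s) / 2.
  apply: (@le_lt_trans _ _ (N%:R * (expR (- s) * expR (- (eta * s))))).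
    rewrite ler_wpM2l ?(ltW NR0)// -expRD ler_expR.
    have := ler_wpM2r (ltW s0) N2.
    rewrite (_ : 2 * s / N%:R = 2 / N%:R * s); last by rewrite mulrAC.
    by rewrite /eta; lra.
  rewrite mulrCA ltr_pM2l ?expR_gt0// expRN ltr_pdivrMr ?expR_gt0//.
  rewrite mulrC -ltr_pdivrMr// invrK.
  apply: lt_le_trans (expR_ge1Dx _).
  have -> : eta * s = 2 * eta + 2 * N%:R by rewrite /s; field; rewrite gt_eqF.
  by rewrite mulrC; lra.
lra.
Qed.

Let g_gt0 : 0 < g. Proof. exact: Gamma_onem_gt0. Qed.

Let cvg_theta (r : R) : 0 < r -> r != 1 ->
  (1 - (r * expR (1 - r)) ^+ m.+1 : R) @[m --> \oo] --> (1 : R).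
Proof.
move=> r0 r1; rewrite -[in X in _ --> X](subr0 1).
apply: cvgB; first exact: cvg_cst.
have : (r * expR (1 - r)) ^+ m @[m --> \oo] --> (0 : R).
  apply: cvg_expr; rewrite ger0_norm ?mul_expR_subr_lt1//.
  by rewrite mulr_ge0 ?expR_ge0// ltW.
by rewrite -cvg_shiftS.
Qed.

(** First m tends to infinity at fixed r < 1, which removes the Chernoff error; then r tends to
    1. *)
Lemma tail_ge_large x : 0 < x -> 1 - expR (- (x `^ (- alpha) / g)) <= tail x.
Proof.
move=> x0; rewrite lerBlDl -lerBlDr.
set c := _ / g.
have main (r : R) : 0 < r -> r < 1 -> 1 - tail x <= expR (- (r * c)).
  move=> r0 r1.
  have c1 : ((1 - (r * expR (1 - r)) ^+ m.+1) * (1 - tail x)) @[m --> \oo] -->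
      1 * (1 - tail x).
    by apply: cvgMl; apply: cvg_theta => //; rewrite lt_eqF.
  rewrite -[leLHS]mul1r; apply: (ler_cvg_to c1 (cvg_cst _)); apply: nearW => m.
  pose l := r * m.+1%:R / x.
  have l0 : 0 < l by rewrite divr_gt0// mulr_gt0.
  have lx : l * x = r * m.+1%:R by rewrite /l divfK// gt_eqF.
  apply: le_trans (tail_poissonized_ge alpha_gt0 alpha_lt1 stableZ (ltW l0) r0 (ltW r1) lx) _.
  rewrite ler_expR lerN2.
  have := sibuya_tail_ge alpha_gt0 alpha_lt1 m.
  set w := \prod_(j < m) _ => hw.
  have r01 : 0 < r <= 1 by rewrite r0 ltW.
  apply: (@le_trans _ _ (r `^ alpha * c)).
    rewrite ler_wpM2r ?divr_ge0 ?powR_ge0 ?(ltW g_gt0)//.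
    exact: ger1_powR (ltW alpha_lt1).
  have -> : l = r * x^-1 * m.+1%:R by rewrite /l mulrAC.
  rewrite !powRM ?mulr_ge0 ?invr_ge0 ?(ltW r0) ?(ltW x0)//.
  have -> : x^-1 `^ alpha = x `^ (- alpha).
    by rewrite -powR_inv1 ?(ltW x0)// -powRrM mulN1r.
  rewrite /c.
  have M0 : 0 < m.+1%:R `^ alpha :> R by rewrite powR_gt0.
  have hw2 : 1 / g <= m.+1%:R `^ alpha * w.
    rewrite ler_pdivrMr// -mulrA -ler_pdivrMl// mulr1 -powRN.
    exact: hw.
  have := ler_wpM2l (mulr_ge0 (powR_ge0 r alpha) (powR_ge0 x (- alpha))) hw2.
  lra.
have c2 : expR (- (r * c)) @[r --> 1^'-] --> expR (- (1 * c)).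
  apply: cvg_at_left_filter.
  have c0 : - (r * c) @[r --> (1 : R)] --> - (1 * c).
    by apply: cvgN; apply: cvgMl; exact: cvg_id.
  by apply: (cvg_comp _ _ c0); exact: continuous_expR.
rewrite -[c]mul1r.
apply: (ler_cvg_to (cvg_cst (1 - tail x)) c2).
near=> r; apply: main; near: r; [exact: nbhs_left_gt|exact: nbhs_left_lt].
Unshelve. all: by end_near. Qed.

Lemma tail_ge_large_optimal c : 1 < c ->
  ~ (forall x, 0 < x -> 1 - expR (- ((x / c) `^ (- alpha) / g)) <= tail x).
Proof.
move=> c1 H; have c0 : 0 < c by exact: lt_trans c1.
(* Midpoint of 1 and [c]: [1 < r] serves Chernoff's bound and [r < c] keeps the gain [k] above 1. *)
pose r := (1 + c) / 2.
have r1 : 1 < r by rewrite /r; lra.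
have rc : r < c by rewrite /r; lra.
have r0 : 0 < r by exact: lt_trans r1.
pose k := (c / r) `^ alpha.
have k1 : 1 < k.
  have := @gt0_ltr_powR _ _ alpha_gt0 1 (c / r); rewrite !nnegrE powR1; apply => //.
    by rewrite divr_ge0// ltW.
  by rewrite ltr_pdivlMr// mul1r.
pose theta m := (r * expR (1 - r)) ^+ m.+1.
(* As m grows, the left side tends to [k], which exceeds 1. *)
have key m : (0 < m)%N -> (1 - theta m) * k * (1 - alpha * m.+1%:R^-1) <= 1.
  move=> m0.
  pose w : R := \prod_(j < m) (1 - alpha / j.+1%:R).
  have M0 : 0 < m.+1%:R :> R by [].
  have w1 : w <= 1.
    rewrite /w; apply: prodr_ile1 => j _.
    rewrite subr_ge0 gerBl divr_ge0 ?(ltW alpha_gt0)//= andbT.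
    by rewrite ler_pdivrMr// mul1r (le_trans (ltW alpha_lt1))// ler1n.
  (* Chosen so that at l^alpha = s and x = r (m+1) / l, the assumed exponent (x/c)^(-alpha) / g
     equals s v. *)
  pose v := k * m.+1%:R `^ (- alpha) / g.
  have k0 : 0 < k := lt_trans ltr01 k1.
  have v0 : 0 < v by apply: divr_gt0 => //; apply: mulr_gt0 => //; exact: powR_gt0.
  set D := 1 - theta m.
  have D1 : D <= 1 by rewrite gerBl exprn_ge0// mulr_ge0 ?expR_ge0// ltW.
  have D0 : 0 <= D.
    rewrite subr_ge0; apply: exprn_ile1.
      by rewrite mulr_ge0 ?expR_ge0 ?(ltW r0).
    by apply/ltW/mul_expR_subr_lt1 => //; rewrite gt_eqF.
  (* First-order comparison as l tends to 0: the constant terms cancel, and division by [s] leaves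
     an error linear in [s]. *)
  have step s : 0 < s -> D * v <= w + s * (1 + D * v ^+ 2).
    move=> s0; pose l := s `^ alpha^-1.
    have l0 : 0 < l by exact: powR_gt0.
    have lE : l `^ alpha = s by rewrite /l -powRrM mulVf// powRr1// ltW.
    pose x := r * m.+1%:R / l.
    have x0 : 0 < x by rewrite divr_gt0// mulr_gt0.
    have lx : l * x = r * m.+1%:R by rewrite /x mulrC divfK// gt_eqF.
    have := tail_poissonized_le alpha_gt0 alpha_lt1 stableZ (ltW l0) m0 (ltW r1) lx.
    rewrite lE -/w -/(theta m) -/D => up.
    have := H x x0.
    have -> : (x / c) `^ (- alpha) / g = s * v.
      have -> : x / c = (c / r)^-1 * (m.+1%:R * l^-1).
        by rewrite /x; field; rewrite !gt_eqF.
      rewrite !powRM ?invr_ge0 ?mulr_ge0 ?divr_ge0 ?invr_ge0 ?(ltW c0) ?(ltW r0) ?(ltW l0)//.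
      have inv y : 0 < y -> y^-1 `^ (- alpha) = y `^ alpha.
        by move=> y0; rewrite -powR_inv1 ?(ltW y0)// -powRrM mulrNN mul1r.
      by rewrite (inv _ (divr_gt0 c0 r0)) (inv _ l0) lE /v /k; ring.
    move=> lo.
    have sv0 : 0 < s * v by exact: mulr_gt0.
    (* With y = s v, use exp(y) >= 1 + y and (1 + y)(1 - y + y^2) = 1 + y^3. *)
    have e1 : expR (- (s * v)) <= 1 - s * v + (s * v) ^+ 2.
      rewrite expRN -div1r ler_pdivrMr ?expR_gt0//.
      have h1 := expR_ge1Dx (s * v).
      have h2 : 0 <= 1 - s * v + (s * v) ^+ 2 by nra.
      have h3 := ler_wpM2l h2 h1.
      have h4 : 0 <= (s * v) ^+ 3 by rewrite exprn_ge0// ltW.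
      lra.
    have h1 := ler_wpM2l D0 (le_trans (lerB (lexx 1) e1) lo).
    have h2 := expR_ge1Dx (- s).
    have w1' : 0 <= 1 + s * (1 - w) by rewrite addr_ge0// mulr_ge0 ?(ltW s0)// subr_ge0.
    have h3 := le_trans (ler_wpM2r w1' h2) up.
    have w0 : 0 <= w.
      have := sibuya_tail_ge alpha_gt0 alpha_lt1 m; rewrite -/w => /(le_trans (powR_ge0 _ _)).
      by rewrite pmulr_lge0.
    rewrite -(ler_pM2l s0).
    have h5 : 0 <= s * s * w by rewrite !mulr_ge0// ltW.
    lra.
  have Dvw : D * v <= w.
    rewrite leNgt; apply/negP => wD.
    have q0 : 0 < 1 + D * v ^+ 2.
      by rewrite (@lt_le_trans _ _ 1)// lerDl mulr_ge0// exprn_ge0// ltW.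
    (* This [s] makes the error half of the gap between [D * v] and [w], a contradiction. *)
    have := step ((D * v - w) / (2 * (1 + D * v ^+ 2))).
    rewrite divr_gt0 ?subr_gt0 ?mulr_gt0// => /(_ isT).
    rewrite (_ : _ / (2 * _) * _ = (D * v - w) / 2); first by lra.
    by field; rewrite gt_eqF.
  have ma : 0 < m.+1%:R - alpha by rewrite subr_gt0 (lt_le_trans alpha_lt1)// ler1n.
  have := sibuya_tail_le alpha_gt0 alpha_lt1 m; rewrite -/w => hw.
  have h1 := le_trans (ler_wpM2l (ltW ma) (ler_wpM2r (ltW g_gt0) Dvw)) hw.
  have vg : v * g = k * m.+1%:R `^ (- alpha) by rewrite /v divfK// gt_eqF.
  have P0 : 0 < m.+1%:R `^ (1 - alpha) :> R by exact: powR_gt0.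
  rewrite -(ler_pM2r P0) mul1r; apply: le_trans h1.
  rewrite -[D * v * g]mulrA vg.
  have -> : m.+1%:R `^ (1 - alpha) = m.+1%:R * m.+1%:R `^ (- alpha) :> R.
    rewrite powRD; last by apply/implyP => _.
    by rewrite powRr1.
  rewrite le_eqVlt; apply/orP; left; apply/eqP; field.
  by rewrite nat1r.
have cv : ((1 - theta m) * k * (1 - alpha * m.+1%:R^-1)) @[m --> \oo] -->
    1 * k * (1 - alpha * 0).
  apply: cvgM; first by apply: cvgMl; apply: cvg_theta => //; rewrite gt_eqF.
  apply: cvgB; first exact: cvg_cst.
  by apply: cvgMr; exact: cvg_harmonic.
have : 1 * k * (1 - alpha * 0) <= 1.
  apply: (ler_cvg_to cv (cvg_cst _)); near=> m; apply: key.
  by near: m; exact: nbhs_infty_gt.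
by rewrite mulr0 subr0 mulr1 mul1r leNgt k1.
Unshelve. all: by end_near. Qed.

End tail_bounds.

(** * Tails of Frechet laws *)

Section frechet.
Context d (T : measurableType d) (R : realType) (Q : probability T R).
Variable L : {RV Q >-> R}.
Hypothesis expL : unit_exponential Q L.
Implicit Types (k x p : R).

Let powR_cancel p x : 0 <= x -> p != 0 -> (x `^ p^-1) `^ p = x.
Proof. by move=> x0 p0; rewrite -powRrM mulVf// powRr1. Qed.

(** For positive [L] the decreasing power turns the event into L <= b, whose probability is the
    exponential distribution function at [b]. *)
Lemma frechet_tail k p x : 0 < k -> 0 < p -> 0 < x ->
  Q [set w | x <= k * L w `^ (- p)] = (1 - expR (- ((k / x) `^ p^-1)))%:E.
Proof.
move=> k0 p0 x0.
set b := (k / x) `^ p^-1.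
have b0 : 0 < b by rewrite powR_gt0// divr_gt0.
pose A : set R := [set t | x <= k * t `^ (- p)].
have mA : measurable A.
  have -> : A = (fun t => k * t `^ (- p)) @^-1` `[x, +oo[.
    by apply/seteqP; split => t /=; rewrite in_itv/= andbT.
  rewrite -[_ @^-1` _]setTI.
  have mf : measurable_fun setT (fun t : R => k * t `^ (- p)).
    by apply: measurable_funM => //; exact: measurable_powR.
  exact: mf.
have -> : Q [set w | x <= k * L w `^ (- p)] = distribution Q L A by [].
rewrite expL// -[in RHS](mul1r b) -mulNr.
rewrite EFinB -(@exponential_prob_itv0c R 1 b b0).
rewrite /exponential_prob integral_mkcond [in RHS]integral_mkcond.
have mpdf (B : set R) : measurable B ->
    measurable_fun setT ((fun t => (exponential_pdf 1 t)%:E) \_ B).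
  move=> mB; apply/(measurable_restrictT _ _).1 => //.
  by apply/measurable_EFinP/measurable_funTS; exact: measurable_exponential_pdf.
apply: ae_eq_integral => //; [exact: mpdf|by apply: mpdf; exact: measurable_itv|].
(* The two sets agree on the positive axis, and the density vanishes on the negative one. At 0 they
   differ, since 0 to the power -p is 0 by convention; a single point is negligible. *)
exists [set 0]; split => //; first exact: lebesgue_measure_set1.
move=> t /= H; apply: contrapT => t0; apply: H => _.
rewrite !patchE; have [tn|tp|//] := ltgtP t 0.
  by rewrite lt0_exponential_pdf//; case: ifP; case: ifP.
suff -> : (t \in A) = (t \in (`[0, b]%classic : set R)) by [].
have -> : (t \in A) = (x <= k * t `^ (- p)) by apply/idP/idP; rewrite inE.
rewrite mem_setE in_itv/= (ltW tp)/=.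
rewrite powRN ler_pdivlMr ?powR_gt0// mulrC -ler_pdivlMr//.
rewrite -{1}(@powR_cancel p (k / x)) ?gt_eqF ?divr_ge0 ?(ltW k0) ?(ltW x0)// -/b.
apply/idP/idP => h.
  rewrite leNgt; apply/negP => bt; move: h; rewrite leNgt => /negP; apply.
  by apply: gt0_ltr_powR; rewrite ?nnegrE ?ltW.
by apply: ge0_ler_powR => //; rewrite ?nnegrE ltW.
Qed.

End frechet.

(** * From tail inequalities to the stochastic order *)

Section assembly.
Context d (T : measurableType d) d' (T' : measurableType d') (R : realType).
Variables (P : probability T R) (Q : probability T' R).
Variables (Z : {RV P >-> R}) (L : {RV Q >-> R}).
Hypotheses (posZ : {ae P, forall w, 0 < Z w}) (expL : unit_exponential Q L).

Let measurable_tail (X : {RV P >-> R}) x : measurable [set w | x <= X w].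
Proof.
have -> : [set w | x <= X w] = X @^-1` `[x, +oo[.
  by apply/seteqP; split => w /=; rewrite in_itv/= andbT.
exact: measurable_funPTI.
Qed.

Let tail_le0 x : x <= 0 -> P [set w | x <= Z w] = 1%E.
Proof.
move=> x0; have -> : 1%E = P setT by rewrite probability_setT.
have [N [mN PN NZ]] := posZ.
apply/eqP; rewrite eq_le; apply/andP; split.
  by apply: le_measure; rewrite ?inE//; exact: measurable_tail.
have : P setT = (P (setT `\` N) + P (setT `&` N))%E.
  exact: measureDI.
rewrite setTI PN adde0 => ->.
apply: le_measure; rewrite ?inE; [exact: measurableD|exact: measurable_tail|].
move=> w [_ Nw] /=; rewrite (le_trans x0)// ltW//.
by apply: contrapT => Zw; apply: Nw; apply: NZ.
Qed.

(** Only [0 < x] carries information: for [x <= 0] the tail of the almost surely positive [Z] is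
    1. *)
Lemma le_st_frechetP k p : 0 < k -> 0 < p ->
  le_st Q P (scale_rv k (power_rv L (- p))) Z <->
  (forall x, 0 < x -> 1 - expR (- ((k / x) `^ p^-1)) <= tail Z x).
Proof.
move=> k0 p0.
have fZ x : P [set w | x <= Z w] = (tail Z x)%:E.
  by rewrite /tail fineK// fin_num_measure//; exact: measurable_tail.
split=> H x.
  move=> x0; have := H x; rewrite fZ.
  by rewrite (frechet_tail expL k0 p0 x0) lee_fin.
have [x0|x0] := leP x 0.
  rewrite tail_le0//; apply: probability_le1.
  have -> : [set w | x <= scale_rv k (power_rv L (- p)) w] =
      (scale_rv k (power_rv L (- p)) : {mfun T' >-> R}) @^-1` `[x, +oo[.
    by apply/seteqP; split => w /=; rewrite in_itv/= andbT.
  exact: measurable_funPTI.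
by rewrite fZ (frechet_tail expL k0 p0 x0) lee_fin; exact: H.
Qed.

(** Scaling by [c] replaces [k] by [c * k], and c k / x = k / (x / c); so optimality reads as the
    failure of the tail bound at [x / c]. *)
Lemma prec_st_frechet k p : 0 < k -> 0 < p ->
  (forall x, 0 < x -> 1 - expR (- ((k / x) `^ p^-1)) <= tail Z x) ->
  (forall c, 1 < c ->
    ~ (forall x, 0 < x -> 1 - expR (- ((k / (x / c)) `^ p^-1)) <= tail Z x)) ->
  prec_st Q P (scale_rv k (power_rv L (- p))) Z.
Proof.
move=> k0 p0 H Hc; split; first exact/le_st_frechetP.
move=> [c [c1 cH]]; apply: (Hc c c1).
have c0 : 0 < c by exact: lt_trans c1.
have := (@le_st_frechetP (c * k) p (mulr_gt0 c0 k0) p0).1.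
move=> /(_ _) K x x0.
have -> : k / (x / c) = c * k / x by field; rewrite !gt_eqF.
apply: K => // y; have := cH y.
rewrite [X in (Q X <= _)%E -> _](_ : _ =
  [set w | y <= scale_rv (c * k) (power_rv L (- p)) w])//.
by apply/seteqP; split => w /=; rewrite /scale_rv mulrA.
Qed.

End assembly.

Theorem mainTheorem4 (R : realType) (alpha : R)
    (alpha_gt0 : 0 < alpha) (alpha_lt1 : alpha < 1)
    (d d' : measure_display)
    (T : measurableType d) (P : probability T R) (Z : {RV P >-> R})
    (T' : measurableType d') (Q : probability T' R) (L : {RV Q >-> R}) :
  positive_stable P alpha Z -> unit_exponential Q L ->
  prec_st Q P
    (scale_rv (alpha * (1 - alpha) `^ ((1 - alpha) / alpha))
              (power_rv L (- ((1 - alpha) / alpha)))) Z /\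
  prec_st Q P
    (scale_rv (Gamma (1 - alpha) `^ (- (1 / alpha)))
              (power_rv L (- (1 / alpha)))) Z.
Proof.
move=> stZ eL; have [posZ _] := stZ.
have oa : 0 < 1 - alpha by rewrite subr_gt0.
have an0 : alpha != 0 by rewrite gt_eqF.
have on0 : 1 - alpha != 0 by rewrite gt_eqF.
have g0 := Gamma_onem_gt0 alpha_gt0 alpha_lt1.
split.
(* The power alpha/(1-alpha) turns the normalizing factor into 1 - alpha, matching the optimized
   Chernoff exponent. *)
- have kE y : 0 < y ->
      (alpha * (1 - alpha) `^ ((1 - alpha) / alpha) / y) `^ ((1 - alpha) / alpha)^-1 =
      (1 - alpha) * (alpha / y) `^ (alpha / (1 - alpha)).
    move=> y0; rewrite mulrAC [LHS]powRM ?powR_ge0 ?divr_ge0 ?(ltW alpha_gt0) ?(ltW y0)//.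
    rewrite -powRrM mulfV ?mulf_neq0 ?invr_eq0// powRr1 ?(ltW oa)//.
    by rewrite invfM invrK mulrC [_^-1 * _]mulrC.
  apply: prec_st_frechet => //.
  + by rewrite mulr_gt0// powR_gt0.
  + by rewrite divr_gt0.
  + by move=> x x0; rewrite kE//; exact: tail_ge_small.
  + move=> c c1 H; apply: (tail_ge_small_optimal alpha_gt0 alpha_lt1 stZ c1) => x x0.
    have := H x x0; rewrite kE// divr_gt0//; exact: lt_trans c1.
- have kE y : 0 < y ->
      (Gamma (1 - alpha) `^ (- (1 / alpha)) / y) `^ (1 / alpha)^-1 =
      y `^ (- alpha) / Gamma (1 - alpha).
    move=> y0; rewrite !div1r invrK powRM ?powR_ge0 ?invr_ge0 ?(ltW y0)//.
    rewrite -powRrM mulNr mulVf// powR_inv1 ?(ltW g0)// mulrC.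
    by rewrite -[y^-1]powR_inv1 ?(ltW y0)// -powRrM mulN1r.
  apply: prec_st_frechet => //.
  + exact: powR_gt0.
  + by rewrite divr_gt0.
  + by move=> x x0; rewrite kE//; exact: tail_ge_large.
  + move=> c c1 H; apply: (tail_ge_large_optimal alpha_gt0 alpha_lt1 stZ c1) => x x0.
    have := H x x0; rewrite kE// divr_gt0//; exact: lt_trans c1.
Qed.
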